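(* Let $g:\mathbb{R}^n\to\mathbb{R}\cup\{\infty\}$ be a proper convex function, let $D\in\mathbb{R}^{n\times n}$ be non-singular, let $f(x)=g(Dx)$, and let $x_0\in\mathbb{R}^n$. Then $$\delta(f,x_0)\le \mathcal{R}_{\mathcal{D}(g,Dx_0)}(D^{-1})^2\cdot\delta(g,Dx_0).$$ In particular, $$\frac{\delta(g,Dx_0)}{\kappa(D)^2}\le\delta(f,x_0)\le\kappa(D)^2\cdot\delta(g,Dx_0).$$
   Context: $\|\cdot\|$ is the Euclidean norm on vectors and the operator norm on matrices, and $S^{k-1}$ is the unit sphere of $\mathbb{R}^k$. For a closed convex cone $K\subseteq\mathbb{R}^k$, $\Pi_K$ is the Euclidean projection onto $K$, and the statistical dimension is $\delta(K)=\mathbb{E}[\|\Pi_K(g)\|^2]$ with $g$ a standard Gaussian vector in $\mathbb{R}^k$. The descent cone of a convex function $f:\mathbb{R}^n\to\mathbb{R}\cup\{\infty\}$ at $x_0$ is $\mathcal{D}(f,x_0)=\bigcup_{\tau>0}\{y\in\mathbb{R}^n: f(x_0+\tau y)\le f(x_0)\}$, and $\delta(f,x_0):=\delta(\mathcal{D}(f,x_0))$. If the descent cone is not closed, it is replaced by its closure in $\delta$ and in $\mathcal{R}$. For $A\in\mathbb{R}^{p\times n}$ put $\sigma(A)=\min_{x\in S^{n-1}}\|Ax\|$ and $\kappa(A)=\min\{\|A\|/\sigma(A),\ \|A\|/\sigma(A^T)\}$. Renegar's condition number of $A\in\mathbb{R}^{p\times n}$ with respect to a closed convex cone $C\subseteq\mathbb{R}^n$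 is $$\mathcal{R}_C(A)=\min\left\{\frac{\|A\|}{\sigma_C(A)},\ \frac{\|A\|}{\sigma_{\mathbb{R}^p\to C}(-A^T)}\right\},$$ where $\sigma_C(A)=\min_{x\in C\cap S^{n-1}}\|Ax\|$ and $\sigma_{\mathbb{R}^p\to C}(-A^T)=\min_{y\in S^{p-1}}\|\Pi_C(-A^Ty)\|$. Conventions: a quotient with zero denominator is $+\infty$; a minimum over the empty set (case $C=\{0\}$) is $+\infty$ and the corresponding quotient is $0$. *)

(* Defs.v *)
From HB Require Import structures.
From mathcomp Require Import all_boot all_order all_algebra.
From mathcomp Require Import all_classical all_reals all_analysis.
Import Order.TTheory GRing.Theory Num.Theory.
Import numFieldNormedType.Exports.

Set Implicit Arguments.
Unset Strict Implicit.
Unset Printing Implicit Defensive.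

Local Open Scope classical_set_scope.
Local Open Scope ring_scope.

(* Vectors of R^n are column vectors 'cV[R]_n. The norm `|x| of the library   *)
(* on them is the sup norm, hence the separate Euclidean norm; the library    *)
(* topology on 'cV[R]_n (used for closures) is the same for both norms.       *)
Section euclidean.
Context {R : realType}.

Definition enorm n (x : 'cV[R]_n) : R := Num.sqrt (\sum_i x i ord0 ^+ 2).

Definition esphere n : set 'cV[R]_n := [set x | enorm x = 1].

Definition opnorm p n (A : 'M[R]_(p, n)) : R :=
  sup [set enorm (A *m x) | x in [set x : 'cV[R]_n | enorm x <= 1]].

(* The nearest point exists and is unique when K is a nonempty closed convex  *)
(* set; xget picks it (0 is the dummy value when there is no such point).     *)
Definition euclid_proj n (K : set 'cV[R]_n) (x : 'cV[R]_n) : 'cV[R]_n :=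
  xget 0 [set y | K y /\ forall z, K z -> enorm (x - y) <= enorm (x - z)].

End euclidean.

Section standard_gaussian.
Context {R : realType}.
Local Notation RB := (measurableTypeR R).

Definition tuple_consp n (x : RB * n.-tuple RB) : n.+1.-tuple RB :=
  [tuple of x.1 :: x.2].

Lemma measurable_tuple_consp n : measurable_fun setT (@tuple_consp n).
Proof. exact: measurable_cons. Qed.

HB.instance Definition _ n :=
  isMeasurableFun.Build _ _ _ _ (@tuple_consp n) (@measurable_tuple_consp n).

(* The law on R^n of n independent N(0, 1) coordinates: the n-fold product of *)
(* the standard normal law, on n-tuples, which carry the product Borel        *)
(* sigma-algebra.                                                             *)
Fixpoint std_gaussian n : probability (n.-tuple RB) R :=
  match n with
  | 0 => dirac ([tuple] : 0.-tuple RB)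
  | m.+1 => distribution (normal_prob (0 : R) 1 \x std_gaussian m)%E
              (@tuple_consp m : {mfun _ >-> _})
  end.

Definition statdim k (K : set 'cV[R]_k) : \bar R :=
  'E_(std_gaussian k)
    [(fun t => enorm (euclid_proj K (\col_(i < k) (tnth t i : R))) ^+ 2)%R]%E.

End standard_gaussian.

Section condition_numbers.
Context {R : realType}.
Local Open Scope ereal_scope.

(* As inve 0 = +oo but 0 * +oo = 0 in the library, 0 / 0 would be 0; here a   *)
(* quotient with zero denominator is always +oo.                              *)
Definition equot (x y : \bar R) : \bar R := if y == 0 then +oo else x / y.

(* The minima below are infima over (compact) sets, in \bar R, so that the    *)
(* minimum over the empty set is +oo.                                         *)
Definition sigma_min p n (A : 'M[R]_(p, n)) : \bar R :=
  ereal_inf [set (enorm (A *m x)%R)%:E | x in @esphere R n].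

Definition kappa p n (A : 'M[R]_(p, n)) : \bar R :=
  mine (equot (opnorm A)%:E (sigma_min A))
       (equot (opnorm A)%:E (sigma_min A^T)).

Definition sigma_cone p n (C : set 'cV[R]_n) (A : 'M[R]_(p, n)) : \bar R :=
  ereal_inf [set (enorm (A *m x)%R)%:E | x in C `&` @esphere R n].

Definition sigma_to_cone p n (C : set 'cV[R]_n) (B : 'M[R]_(n, p)) : \bar R :=
  ereal_inf [set (enorm (euclid_proj C (B *m y)%R))%:E | y in @esphere R p].

Definition renegar p n (C : set 'cV[R]_n) (A : 'M[R]_(p, n)) : \bar R :=
  mine (equot (opnorm A)%:E (sigma_cone C A))
       (equot (opnorm A)%:E (sigma_to_cone C (- A^T)%R)).

End condition_numbers.

Section descent_cones.
Context {R : realType} {n : nat}.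
Implicit Types (f : 'cV[R]_n -> \bar R) (x : 'cV[R]_n).

Definition proper_fun f :=
  (forall x, f x != -oo%E) /\ (exists x, f x != +oo%E).

Definition convex_efun f := forall (t : R) x y, 0 <= t <= 1 ->
  (f (t *: x + (1 - t) *: y)%R <= t%:E * f x + (1 - t)%R%:E * f y)%E.

Definition descent_cone f x : set 'cV[R]_n :=
  \bigcup_(tau in [set tau : R | 0 < tau])
    [set y | (f (x + tau *: y)%R <= f x)%E].

Definition closed_descent_cone f x : set 'cV[R]_n := closure (descent_cone f x).

Definition statdim_at f x : \bar R := statdim (closed_descent_cone f x).

End descent_cones.

(* Main.v *)
From HB Require Import structures.
Require Import Defs.
From mathcomp Require Import all_boot all_order all_algebra.
From mathcomp Require Import all_classical all_reals all_analysis.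
From mathcomp Require Import measurable_realfun ring lra.

Import Order.TTheory GRing.Theory Num.Theory.
Import numFieldNormedType.Exports.

Set Implicit Arguments.
Unset Strict Implicit.
Unset Printing Implicit Defensive.

Local Open Scope classical_set_scope.
Local Open Scope ring_scope.

(** Write C for the closed descent cone of g at D x0, T for the inverse of D
    and K for the closed descent cone of f at x0. Both cones are closed and
    convex, and K is the image of C under T. The proof rests on two facts.

    Geometry. Let h_C x be the norm of the projection of x onto C. The first
    order optimality of the projection shows that h_C x is the least L >= 0 with
    <x, z> <= L |z| for all z in C ([pnorm_sqr], [dot_le_pnorm], [pnorm_le]).
    Hence h_C is convex and 1-Lipschitz, and a bound |D z| <= L |z| on K gives
    <x, z> = <T^T x, D z> <= L h_C (T^T x) |z|, that is h_K x <= L h_C (T^T x).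
    The constant L = 1 / sigma_C(T) serves for the first quotient of the Renegar
    condition number. For the second one, h_K x <= |x| and the definition of
    the restricted singular value of - T^T at the vector - x give the same
    bound with L the inverse of that value.

    Probability. It remains to compare E h_C (B g)^2 with E h_C (g)^2 for
    B = T^T. If |B x| <= |x| for all x, then E F (B g) <= E F (g) for every
    nonnegative measurable convex F ([gauss_dominated_contraction]); scaling
    gives E h_C (B g)^2 <= |B|^2 E h_C (g)^2. The reason is that a contraction
    is an average of orthogonal matrices, under which the law of g is invariant.
    The proof is an induction on the dimension. The matrices with the required
    property are closed under products and contain the rotations of the first
    two coordinates, the matrices diag(s, 1) with |s| <= 1, since diag(s, 1)
    averages diag(1, 1) and diag(-1, 1), and the matrices diag(1, B') with B' in
    the class one dimension lower. They contain an orthogonal matrix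
    carrying any given unit vector to the first basis vector, together with its
    transpose ([rotate_to_first]). Two such matrices move a direction of maximal
    stretch of B and its image to the first axis, which brings B to the form
    diag(s, B') with B' a contraction, and the induction hypothesis applies.
    Invariance under plane rotations comes from the factorisation of a rotation
    into three shears, which preserve Lebesgue measure.

    With a = |D| and any b such that |T x| <= b |x|, the two facts applied to K
    and C, then to C and K, give the two-sided estimate with the factor (a b)^2.
    Both quotients in kappa(D) are of the form a b. *)

(** * Euclidean geometry in coordinates *)

Section euclidean_geometry.
Context {R : realType}.

Definition dot n (x y : 'cV[R]_n) : R := \sum_i x i ord0 * y i ord0.

Lemma dotC n (x y : 'cV[R]_n) : dot x y = dot y x.
Proof. by apply: eq_bigr => i _; rewrite mulrC. Qed.

Lemma dotDl n (x y z : 'cV[R]_n) : dot (x + y) z = dot x z + dot y z.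
Proof. by rewrite -big_split; apply: eq_bigr => i _; rewrite mxE mulrDl. Qed.

Lemma dotZl n a (x y : 'cV[R]_n) : dot (a *: x) y = a * dot x y.
Proof. by rewrite mulr_sumr; apply: eq_bigr => i _; rewrite mxE mulrA. Qed.

Lemma dotNl n (x y : 'cV[R]_n) : dot (- x) y = - dot x y.
Proof. by rewrite -scaleN1r dotZl mulN1r. Qed.

Lemma dotBl n (x y z : 'cV[R]_n) : dot (x - y) z = dot x z - dot y z.
Proof. by rewrite dotDl dotNl. Qed.

Lemma dotDr n (x y z : 'cV[R]_n) : dot x (y + z) = dot x y + dot x z.
Proof. by rewrite dotC dotDl !(dotC x). Qed.

Lemma dotZr n a (x y : 'cV[R]_n) : dot x (a *: y) = a * dot x y.
Proof. by rewrite dotC dotZl dotC. Qed.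

Lemma dotNr n (x y : 'cV[R]_n) : dot x (- y) = - dot x y.
Proof. by rewrite dotC dotNl dotC. Qed.

Lemma dotBr n (x y z : 'cV[R]_n) : dot x (y - z) = dot x y - dot x z.
Proof. by rewrite dotDr dotNr. Qed.

Lemma dot0l n (x : 'cV[R]_n) : dot 0 x = 0.
Proof. by rewrite -(scale0r (0 : 'cV[R]_n)) dotZl mul0r. Qed.

Lemma dot_mulmx p n (A : 'M[R]_(p, n)) x y : dot (A *m x) y = dot x (A^T *m y).
Proof.
rewrite /dot; under eq_bigr do rewrite mxE mulr_suml.
rewrite exchange_big; apply: eq_bigr => j _ /=.
rewrite mxE mulr_sumr; apply: eq_bigr => i _.
by rewrite mxE mulrA; congr (_ * _); rewrite mulrC.
Qed.

Lemma dot_ge0 n (x : 'cV[R]_n) : 0 <= dot x x.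
Proof. by apply: sumr_ge0 => i _; rewrite -expr2 sqr_ge0. Qed.

Lemma enorm_ge0 n (x : 'cV[R]_n) : 0 <= enorm x.
Proof. exact: sqrtr_ge0. Qed.

Lemma enorm_sqr n (x : 'cV[R]_n) : enorm x ^+ 2 = dot x x.
Proof.
rewrite sqr_sqrtr; first by apply: eq_bigr => i _; rewrite expr2.
by apply: sumr_ge0 => i _; rewrite sqr_ge0.
Qed.

Lemma coord_le_enorm n (x : 'cV[R]_n) i j : `|x i j| <= enorm x.
Proof.
rewrite -ler_sqr ?nnegrE ?enorm_ge0// enorm_sqr real_normK ?num_real//.
rewrite [j]ord1 /dot (bigD1 i)//= -expr2 lerDl.
by apply: sumr_ge0 => k _; rewrite -expr2 sqr_ge0.
Qed.

Lemma enorm_eq0 n (x : 'cV[R]_n) : (enorm x == 0) = (x == 0).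
Proof.
apply/eqP/eqP => [x0|->].
  apply/matrixP => i j; apply/eqP; rewrite mxE -normr_le0 -x0.
  exact: coord_le_enorm.
by apply/eqP; rewrite -sqrf_eq0 enorm_sqr dot0l.
Qed.

Lemma enorm0 n : enorm (0 : 'cV[R]_n) = 0.
Proof. by apply/eqP; rewrite enorm_eq0. Qed.

Lemma enormZ n a (x : 'cV[R]_n) : enorm (a *: x) = `|a| * enorm x.
Proof.
apply/eqP; rewrite -(@eqrXn2 _ 2) ?mulr_ge0 ?enorm_ge0//; apply/eqP.
by rewrite exprMn !enorm_sqr dotZl dotZr real_normK ?num_real// mulrA -expr2.
Qed.

Lemma enormN n (x : 'cV[R]_n) : enorm (- x) = enorm x.
Proof. by rewrite -scaleN1r enormZ normrN1 mul1r. Qed.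

Lemma enorm_distC n (x y : 'cV[R]_n) : enorm (x - y) = enorm (y - x).
Proof. by rewrite -enormN opprB. Qed.

Lemma cauchy_schwarz n (x y : 'cV[R]_n) : dot x y <= enorm x * enorm y.
Proof.
have [->|y0] := eqVneq y 0; first by rewrite dotC dot0l enorm0 mulr0.
have y2 : 0 < enorm y ^+ 2 by rewrite exprn_gt0// lt_def enorm_ge0 enorm_eq0 y0.
have := dot_ge0 (enorm y ^+ 2 *: x - dot x y *: y).
rewrite dotBl !dotBr !dotZl !dotZr (dotC y x) -!enorm_sqr => h.
apply: le_trans (ler_norm _) _.
rewrite -ler_sqr ?nnegrE ?mulr_ge0 ?enorm_ge0// real_normK ?num_real//.
rewrite exprMn -subr_ge0 -(pmulr_rge0 _ y2); apply: le_trans h _.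
by rewrite le_eqVlt; apply/orP; left; apply/eqP; ring.
Qed.

Lemma enormD n (x y : 'cV[R]_n) : enorm (x + y) <= enorm x + enorm y.
Proof.
rewrite -ler_sqr ?nnegrE ?addr_ge0 ?enorm_ge0// sqrrD !enorm_sqr.
rewrite dotDl !dotDr (dotC y x); have := cauchy_schwarz x y; lra.
Qed.

Lemma enorm_dist_lip n (x y : 'cV[R]_n) : `|enorm x - enorm y| <= enorm (x - y).
Proof.
have h1 := enormD (x - y) y; have h2 := enormD (y - x) x.
rewrite !subrK (enorm_distC y x) in h1 h2.
by rewrite ler_norml; apply/andP; split; lra.
Qed.

Lemma enorm_le_sum n (x : 'cV[R]_n) : enorm x <= \sum_i `|x i ord0|.
Proof.
rewrite -ler_sqr ?nnegrE ?enorm_ge0 ?sumr_ge0// enorm_sqr /dot expr2 mulr_suml.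
apply: ler_sum => i _; rewrite (le_trans (ler_norm _))// normrM ler_wpM2l//.
by rewrite (bigD1 i)//= lerDl sumr_ge0.
Qed.

Lemma mulmx_bounded p n (A : 'M[R]_(p, n)) :
  exists2 M, 0 < M & forall x, enorm (A *m x) <= M * enorm x.
Proof.
(* The summand 1 makes the bound positive, so that it can be a divisor. *)
exists (1 + \sum_i \sum_j `|A i j|).
  by rewrite ltr_wpDr// sumr_ge0// => i _; rewrite sumr_ge0.
move=> x; rewrite (le_trans (enorm_le_sum _))// mulrDl mul1r.
rewrite -[leLHS]add0r lerD ?enorm_ge0// mulr_suml ler_sum// => i _.
rewrite mxE (le_trans (ler_norm_sum _ _ _))// mulr_suml ler_sum// => j _.
by rewrite normrM ler_wpM2l// coord_le_enorm.
Qed.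

(** |A^T y|^2 = <y, A A^T y> <= s |y| |A^T y|. *)
Lemma trmx_contraction n p (A : 'M[R]_(p, n)) s : 0 <= s ->
  (forall x, enorm (A *m x) <= s * enorm x) ->
  forall y, enorm (A^T *m y) <= s * enorm y.
Proof.
move=> s0 As y; have [->|Ay0] := eqVneq (enorm (A^T *m y)) 0.
  by rewrite mulr_ge0// enorm_ge0.
have Ay : 0 < enorm (A^T *m y) by rewrite lt_def Ay0 enorm_ge0.
rewrite -(ler_pM2l Ay) -expr2 enorm_sqr dot_mulmx trmxK.
rewrite (le_trans (cauchy_schwarz _ _))// [leLHS]mulrC.
by rewrite [leRHS]mulrA (mulrC _ s) ler_wpM2r ?enorm_ge0.
Qed.

(** The topology of column vectors comes from the sup norm; this lemma and the
    next one express it by Euclidean distances. *)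
Lemma nbhs_enormP n (x : 'cV[R]_n) (A : set 'cV[R]_n) :
  nbhs x A <-> exists2 e, 0 < e & forall y, enorm (x - y) < e -> A y.
Proof.
split=> [/nbhs_ballP[e e0 eA]|[e e0 eA]].
  exists e => // y xy; apply: eA; split=> // i j.
  have := coord_le_enorm (x - y) i j; rewrite !mxE => h.
  exact: le_lt_trans xy.
apply/nbhs_ballP; exists (e / n.+1%:R) => /=; first by rewrite divr_gt0.
move=> y [_ xy]; apply: eA; apply: le_lt_trans (enorm_le_sum _) _.
apply: (@le_lt_trans _ _ (\sum_(i < n) e / n.+1%:R)).
  apply: ler_sum => i _; have /ltW := xy i ord0.
  by rewrite !mxE.
rewrite sumr_const card_ord -[ltLHS]mulr_natr -mulrA gtr_pMr//.
by rewrite mulrC ltr_pdivrMr// mul1r ltr_nat.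
Qed.

Lemma closure_enormP n (A : set 'cV[R]_n) x :
  closure A x <-> forall e, 0 < e -> exists2 y, A y & enorm (x - y) < e.
Proof.
split=> [Ax e e0|Ax B /nbhs_enormP[e e0 eB]].
  have [|y [Ay /= xy]] := Ax [set y | enorm (x - y) < e]; last by exists y.
  by apply/nbhs_enormP; exists e.
by have [y Ay /eB By] := Ax _ e0; exists y.
Qed.

Lemma lipschitz_enorm_continuous n (f : 'cV[R]_n -> R) L :
  (forall x y, `|f x - f y| <= L * enorm (x - y)) -> continuous f.
Proof.
move=> fL x B /nbhs_ballP[e /= e0 eB].
apply/nbhs_enormP; exists (e / (`|L| + 1)) => [|y].
  by rewrite divr_gt0// ltr_wpDl.
rewrite ltr_pdivlMr ?ltr_wpDl// => xy; apply: eB.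
apply: le_lt_trans (fL _ _) _.
apply: le_lt_trans xy; rewrite mulrC ler_wpM2l ?enorm_ge0//.
by rewrite (le_trans (ler_norm _))// lerDl.
Qed.

(** Compactness in the form used for nearest points and for directions of
    maximal stretch. *)
Lemma bounded_closed_argmin n (A : set 'cV[R]_n) (M L : R) (f : 'cV[R]_n -> R) :
  A !=set0 -> closed A -> (forall x, A x -> enorm x <= M) ->
  (forall x y, `|f x - f y| <= L * enorm (x - y)) ->
  exists2 c, A c & forall x, A x -> f c <= f x.
Proof.
move=> [a Aa] clA bA fL.
(* Heine-Borel is applied to row vectors. *)
have ctr : continuous (fun r : 'rV[R]_n => r^T).
  move=> r B /nbhs_ballP[e e0 eB]; apply/nbhs_ballP; exists e => // s [_ rs].
  by apply: eB; split=> // i j; rewrite !mxE; exact: rs.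
have [] := @compact_EVT_min _ R (f \o trmx) ((fun r : 'rV[R]_n => r^T) @^-1` A).
- by exists a^T; rewrite /preimage/= trmxK.
- apply: bounded_closed_compact.
    exists M; split; first exact: num_real.
    move=> K MK r Ar; apply: (le_trans _ (ltW MK)).
    rewrite /Num.norm/= mx_normrE; apply/bigmax_leP; split=> /=.
      by rewrite (le_trans (enorm_ge0 _) (bA _ Ar)).
    move=> ij _; rewrite (le_trans _ (bA _ Ar))//.
    by have := coord_le_enorm r^T ij.2 ij.1; rewrite mxE.
  by apply: closed_comp => // x _; exact: ctr.
- apply: continuous_subspaceT => r; apply: continuous_comp; first exact: ctr.
  exact: (lipschitz_enorm_continuous fL).
- move=> c; rewrite inE => Ac cmin; exists c^T => // x Ax.
  by have := cmin x^T; rewrite inE /preimage/= trmxK; exact.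
Qed.

End euclidean_geometry.

(** * Plane rotations and the normal law *)

Section lebesgue_translation.
Context {R : realType}.
Local Notation RB := (measurableTypeR R).
Local Notation mu := (@lebesgue_measure R).

Lemma measurable_translate (a : R) :
  measurable_fun [set: RB] ((fun x => x + a) : RB -> RB).
Proof. exact: measurable_funD. Qed.

(** Both sides are measures that agree on half-open intervals. *)
Lemma lebesgue_measure_translate (a : R) (A : set RB) : measurable A ->
  mu ((fun x => x + a) @^-1` A) = mu A.
Proof.
move=> mA.
have mt := measurable_translate a.
pose tr : {mfun RB >-> RB} := HB.pack ((fun x => x + a) : RB -> RB)
  (isMeasurableFun.Build _ _ _ _ _ mt).
apply/esym.
apply: (lebesgue_measure_unique (mu := pushforward mu tr)) => //.
move=> X [[b c] _ <-] /=.
transitivity (mu `]b - a, c - a]%classic); last first.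
  congr (mu _); apply/seteqP.
  by split=> x; rewrite /preimage /= !in_itv/= ltrBlDr lerBrDr.
rewrite !lebesgue_measure_itv/= !lte_fin ltrD2r -!EFinB.
by rewrite opprB addrA subrK.
Qed.

Lemma ge0_integral_translate (a : R) (f : RB -> \bar R) :
  measurable_fun setT f -> (forall x, 0 <= f x)%E ->
  (\int[mu]_x f (x + a)%R = \int[mu]_x f x)%E.
Proof.
move=> mf f0.
have mt := measurable_translate a.
rewrite -[LHS](ge0_integral_pushforward mt mu (D := setT) (f := f))//.
apply: eq_measure_integral => A mA _.
exact: lebesgue_measure_translate.
Qed.

End lebesgue_translation.

Section density.
Context {R : realType}.
Local Notation RB := (measurableTypeR R).
Local Notation mu := (@lebesgue_measure R).
Import HBNNSimple.

(** The Radon-Nikodym derivative of the normal law is a.e. its density. *)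
Lemma ge0_integral_normal_prob (f : RB -> \bar R) :
  measurable_fun setT f -> (forall x, 0 <= f x)%E ->
  (\int[normal_prob (0 : R) 1]_x f x =
   \int[mu]_x (f x * (normal_pdf 0 1 x)%:E))%E.
Proof.
move=> mf f0.
have dom := @normal_prob_dominates R 0 1.
rewrite -(Radon_Nikodym_SigmaFinite.change_of_variables dom)//=.
apply: ae_eq_integral => //.
- apply: emeasurable_funM => //; apply: (measurable_int mu).
  exact: Radon_Nikodym_SigmaFinite.f_integrable.
- apply: emeasurable_funM => //=; apply/measurableT_comp => //=.
  exact: measurable_normal_pdf.
- apply: ae_eqe_mul2l => /=.
  apply: integral_ae_eq => //=.
  + exact: Radon_Nikodym_SigmaFinite.f_integrable.
  + by apply/measurableT_comp =>//; exact: measurable_normal_pdf.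
  + move=> E _ mE; rewrite -Radon_Nikodym_SigmaFinite.f_integral//.
Qed.
End density.

Section plane_rotation.
Context {R : realType}.
Local Notation RB := (measurableTypeR R).
Local Notation mu := (@lebesgue_measure R).
Local Notation gamma := (@normal_prob R 0 1).

Lemma ge0_integral_shear_snd (t : R) (H : RB * RB -> \bar R) :
  measurable_fun setT H -> (forall z, 0 <= H z)%E ->
  (\int[mu]_x \int[mu]_y H (x, (y + t * x)%R)
   = \int[mu]_x \int[mu]_y H (x, y))%E.
Proof.
move=> mH H0; apply: eq_integral => x _.
rewrite -(ge0_integral_translate (t * x) (f := fun y => H (x, y)))//.
exact: measurableT_comp.
Qed.

Lemma measurable_shear_fst (t : R) :
  measurable_fun [set: RB * RB]
    ((fun z => (z.1 + t * z.2, z.2)) : RB * RB -> RB * RB).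
Proof.
apply/measurable_fun_pairP; split => /=; last exact: measurable_snd.
by apply: measurable_funD => //; apply: measurable_funM.
Qed.

Lemma measurable_shear_snd (t : R) :
  measurable_fun [set: RB * RB]
    ((fun z => (z.1, z.2 + t * z.1)) : RB * RB -> RB * RB).
Proof.
apply/measurable_fun_pairP; split => /=; first exact: measurable_fst.
by apply: measurable_funD => //; apply: measurable_funM.
Qed.

Lemma ge0_integral_shear_fst (t : R) (H : RB * RB -> \bar R) :
  measurable_fun setT H -> (forall z, 0 <= H z)%E ->
  (\int[mu]_x \int[mu]_y H ((x + t * y)%R, y)
   = \int[mu]_x \int[mu]_y H (x, y))%E.
Proof.
move=> mH H0.
pose H' z := H (z.1 + t * z.2, z.2).
have mH' : measurable_fun setT H'.
  by apply: (measurableT_comp mH); exact: measurable_shear_fst.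
apply: (etrans (fubini_tonelli (m1 := mu) (m2 := mu) H' mH' _)).
  by move=> z; exact: H0.
apply/esym/(etrans (fubini_tonelli (m1 := mu) (m2 := mu) H mH H0))/esym.
apply: eq_integral => y _.
rewrite -(ge0_integral_translate (t * y) (f := fun x => H (x, y)))//.
exact: measurableT_comp.
Qed.

(** With t = - tan (theta / 2) = - s / (1 + c), the rotation (c, s) is the
    composite of the shears x += t y, y += s x, x += t y. The half
    turn c = -1 is excluded because t is then undefined. *)
Lemma lebesgue_integral_rotation (c s : R) (H : RB * RB -> \bar R) :
  c ^+ 2 + s ^+ 2 = 1 -> c != -1 ->
  measurable_fun setT H -> (forall z, 0 <= H z)%E ->
  (\int[mu]_x \int[mu]_y H ((c * x - s * y)%R, (s * x + c * y)%R)
   = \int[mu]_x \int[mu]_y H (x, y))%E.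
Proof.
move=> cs1 cN1 mH H0; pose t := - (s / (1 + c)).
have c1 : 1 + c != 0 by rewrite addrC addr_eq0.
have ts : t * s = c - 1.
  have -> : t * s = - (s ^+ 2) / (1 + c) by rewrite /t; field.
  have -> : s ^+ 2 = 1 - c ^+ 2 by rewrite -cs1; ring.
  by field.
have tc : t * (1 + c) = - s by rewrite /t; field.
pose H1 z := H (z.1 + t * z.2, z.2).
pose H2 z := H1 (z.1, z.2 + s * z.1).
have mH1 : measurable_fun setT H1.
  by apply: (measurableT_comp mH); exact: measurable_shear_fst.
have mH2 : measurable_fun setT H2.
  by apply: (measurableT_comp mH1); exact: measurable_shear_snd.
rewrite -(ge0_integral_shear_fst t mH H0).
rewrite -(ge0_integral_shear_snd s mH1); last by move=> z; exact: H0.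
rewrite -(ge0_integral_shear_fst t mH2); last by move=> z; exact: H0.
apply: eq_integral => x _; apply: eq_integral => y _.
rewrite /H2 /H1 /=; congr (H (_, _)).
  transitivity (x + t * s * x + t * (1 + c) * y + t * y * (t * s - (c - 1))).
    by rewrite ts tc; ring.
  by ring.
transitivity (y + s * x + t * s * y); last by ring.
by rewrite ts; ring.
Qed.

Lemma normal_pdf_rotation (c s x y : R) : c ^+ 2 + s ^+ 2 = 1 ->
  normal_pdf 0 1 (c * x - s * y) * normal_pdf 0 1 (s * x + c * y)
  = normal_pdf 0 1 x * normal_pdf 0 1 y :> R.
Proof.
move=> cs1; rewrite !normal_pdfE ?oner_neq0// mulrACA [RHS]mulrACA.
congr (_ * _); rewrite /normal_fun -!expRD; congr expR.
rewrite -!mulrDl; congr (_ / _); rewrite !subr0.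
transitivity (- (c ^+ 2 + s ^+ 2) * (x ^+ 2 + y ^+ 2)); first by ring.
by rewrite cs1; ring.
Qed.

(** The iterated normal integral as an iterated Lebesgue integral against the
    joint density. *)
Lemma normal_integral2E (G : RB * RB -> \bar R) :
  measurable_fun setT G -> (forall z, 0 <= G z)%E ->
  (\int[gamma]_x \int[gamma]_y G (x, y) =
  \int[mu]_x \int[mu]_y (G (x, y) * (normal_pdf 0 1 x * normal_pdf 0 1 y)%:E))%E.
Proof.
move=> mG G0.
have mGx x : measurable_fun setT (fun y => G (x, y)).
  exact: measurableT_comp.
rewrite ge0_integral_normal_prob; last 2 first.
  exact: (measurable_fun_fubini_tonelli_F (m2 := gamma) G).
  by move=> x; apply: integral_ge0 => y _; exact: G0.
apply: eq_integral => x _.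
rewrite ge0_integral_normal_prob// -ge0_integralZr//.
- by apply: eq_integral => y _; rewrite -muleA -EFinM mulrC.
- apply: emeasurable_funM => //; apply/measurable_EFinP.
  exact: measurable_normal_pdf.
- by move=> y _; rewrite mule_ge0// lee_fin normal_pdf_ge0.
- by rewrite lee_fin normal_pdf_ge0.
Qed.

Lemma normal_integral_rotation (c s : R) (G : RB * RB -> \bar R) :
  c ^+ 2 + s ^+ 2 = 1 -> c != -1 ->
  measurable_fun setT G -> (forall z, 0 <= G z)%E ->
  (\int[gamma]_x \int[gamma]_y G ((c * x - s * y)%R, (s * x + c * y)%R)
   = \int[gamma]_x \int[gamma]_y G (x, y))%E.
Proof.
move=> cs1 cN1 mG G0.
have mrot : measurable_fun [set: RB * RB]
    ((fun z => (c * z.1 - s * z.2, s * z.1 + c * z.2)) : RB * RB -> RB * RB).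
  apply/measurable_fun_pairP; split => /=.
    by apply: measurable_funB; apply: measurable_funM.
  by apply: measurable_funD; apply: measurable_funM.
apply: (etrans (normal_integral2E (measurableT_comp mG mrot) _)).
  by move=> z; exact: G0.
apply/esym/(etrans (normal_integral2E mG G0))/esym.
pose H z := (G z * (normal_pdf 0 1 z.1 * normal_pdf 0 1 z.2)%:E)%E.
have mH : measurable_fun setT H.
  apply: emeasurable_funM => //; apply/measurable_EFinP.
  by apply: measurable_funM; apply: measurableT_comp => //;
    exact: measurable_normal_pdf.
have H0 z : (0 <= H z)%E.
  by rewrite mule_ge0// lee_fin mulr_ge0// normal_pdf_ge0.
apply/esym/(etrans (esym (lebesgue_integral_rotation cs1 cN1 mH H0)))/esym.
apply: eq_integral => x _; apply: eq_integral => y _.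
by rewrite /H /= normal_pdf_rotation.
Qed.

(** A quarter turn exchanges the two coordinates up to a sign, so that the
    symmetry of the one-dimensional law is a case of rotation invariance. *)
Lemma normal_integral_opp (f : RB -> \bar R) :
  measurable_fun setT f -> (forall x, 0 <= f x)%E ->
  (\int[gamma]_x f (- x)%R = \int[gamma]_x f x)%E.
Proof.
move=> mf f0.
have mf1 : measurable_fun [set: RB * RB] (fun z => f z.1).
  exact: measurableT_comp.
have e01 : 0 ^+ 2 + 1 ^+ 2 = 1 :> R by rewrite expr0n expr1n add0r.
have n01 : 0 != -1 :> R by rewrite eq_sym oppr_eq0 oner_eq0.
have gcst (e : \bar R) : (\int[gamma]__ e = e)%E.
  apply: (etrans (integral_cst _ measurableT e)); rewrite -[RHS]mule1.
  by congr mule; exact: probability_setT.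
have rot := normal_integral_rotation e01 n01 mf1 (fun z => f0 z.1).
transitivity (\int[gamma]_x \int[gamma]_y f (0 * x - 1 * y)%R)%E.
  rewrite -[LHS]gcst; apply: eq_integral => x _; apply: eq_integral => y _.
  by rewrite mul0r sub0r mul1r.
by rewrite rot /=; apply: eq_integral => x _; exact: gcst.
Qed.

End plane_rotation.

(** * Expectations under the standard Gaussian law *)

Section gaussian_expectation.
Context {R : realType}.
Local Notation RB := (measurableTypeR R).
Local Notation gamma := (@normal_prob R 0 1).

Definition col_tuple n (t : n.-tuple RB) : 'cV[R]_n := \col_i (tnth t i : R).

Definition vcons n (x : R) (v : 'cV[R]_n) : 'cV[R]_n.+1 := col_mx (x%:M) v.

(** The Gaussian law lives on tuples, hence the composition with [col_tuple]. *)
Definition gauss_measurable n (F : 'cV[R]_n -> R) :=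
  measurable_fun [set: n.-tuple RB] (F \o @col_tuple n).

Definition gaussE n (F : 'cV[R]_n -> R) : \bar R :=
  (\int[std_gaussian n]_t (F (col_tuple t))%:E)%E.

Lemma col_tuple_consp n (x : RB) (t : n.-tuple RB) :
  col_tuple (tuple_consp (x, t)) = vcons x (col_tuple t).
Proof.
apply/matrixP => i j; rewrite /vcons !mxE.
case: splitP => k ik; rewrite !mxE.
  by rewrite [k]ord1 in ik *; rewrite (_ : i = ord0) ?tnth0 ?[j]ord1 ?eqxx//;
    exact: val_inj.
by rewrite (_ : i = lift ord0 k) ?tnthS//; exact: val_inj.
Qed.

(** Tonelli: the first coordinate is integrated last. *)
Lemma ge0_gaussE_vcons n (F : 'cV[R]_n.+1 -> R) : gauss_measurable F ->
  (forall v, 0 <= F v) ->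
  gaussE F = (\int[gamma]_x gaussE (fun v => F (vcons x v)))%E.
Proof.
move=> mF F0.
have mFE : measurable_fun [set: n.+1.-tuple RB] (fun t => (F (col_tuple t))%:E).
  exact/measurable_EFinP.
apply: (etrans (ge0_integral_pushforward (@measurable_tuple_consp R n) _ measurableT mFE _)).
  by move=> t _; rewrite lee_fin.
rewrite preimage_setT.
pose H z := ((F (col_tuple (tuple_consp z)))%:E).
have mH : measurable_fun [set: RB * n.-tuple RB] H.
  apply: (measurableT_comp mFE); exact: measurable_tuple_consp.
apply: (etrans (fubini_tonelli1 (m1 := gamma) (m2 := std_gaussian n) H mH _)).
  by move=> t; rewrite lee_fin.
apply: eq_integral => x _; apply: eq_integral => t _.
by rewrite /H col_tuple_consp.
Qed.

End gaussian_expectation.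

Section contraction.
Context {R : realType}.
Local Notation RB := (measurableTypeR R).
Local Notation gamma := (@normal_prob R 0 1).

Lemma measurable_col_tuple_mul p n (T : 'M[R]_(p, n)) :
  measurable_fun [set: n.-tuple RB]
    ((fun t => [tuple (T *m col_tuple t) i ord0 | i < p]) : _ -> p.-tuple RB).
Proof.
apply/measurable_fun_tnthP => i.
rewrite (_ : _ \o _ = fun t : n.-tuple RB => \sum_j T i j * tnth t j).
  apply: measurable_sum => j; apply: measurable_funM => //.
  exact: measurable_tnth.
apply/funext => t /=; rewrite tnth_mktuple mxE.
by apply: eq_bigr => j _; rewrite mxE.
Qed.

Lemma gauss_measurable_mul p n (T : 'M[R]_(p, n)) (F : 'cV[R]_p -> R) :
  gauss_measurable F -> gauss_measurable (fun v => F (T *m v)).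
Proof.
move=> mF; have := measurableT_comp mF (measurable_col_tuple_mul T).
congr measurable_fun; apply/funext => t /=; congr F.
by apply/matrixP => i j; rewrite mxE tnth_mktuple [j]ord1.
Qed.

Lemma gauss_measurable_vcons n x (F : 'cV[R]_n.+1 -> R) :
  gauss_measurable F -> gauss_measurable (fun v => F (vcons x v)).
Proof.
move=> mF.
have mc : measurable_fun [set: n.-tuple RB] (fun t => tuple_consp (x : RB, t)).
  apply: measurableT_comp => //; exact: measurable_tuple_consp.
have := measurableT_comp mF mc.
by congr measurable_fun; apply/funext => t /=; rewrite col_tuple_consp.
Qed.

Lemma gauss_measurable_consp n (F : 'cV[R]_n.+1 -> R) : gauss_measurable F ->
  measurable_fun [set: RB * n.-tuple RB] (fun z => F (vcons z.1 (col_tuple z.2))).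
Proof.
move=> mF; have := measurableT_comp mF (@measurable_tuple_consp R n).
by congr measurable_fun; apply/funext => -[x t] /=; rewrite col_tuple_consp.
Qed.

Lemma gaussE_ge0 n (F : 'cV[R]_n -> R) : (forall v, 0 <= F v) -> (0 <= gaussE F)%E.
Proof. by move=> F0; apply: integral_ge0 => t _; rewrite lee_fin. Qed.

Lemma measurable_gaussE_vcons n (F : 'cV[R]_n.+1 -> R) : gauss_measurable F ->
  (forall v, 0 <= F v) ->
  measurable_fun [set: RB] (fun x => gaussE (fun v => F (vcons x v))).
Proof.
move=> mF F0.
apply: (measurable_fun_fubini_tonelli_F (m2 := std_gaussian n)
  (fun z => (F (vcons z.1 (col_tuple z.2)))%:E)).
  by apply/measurable_EFinP; exact: gauss_measurable_consp.
by move=> z; rewrite lee_fin.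
Qed.

Lemma gaussE_le n (F G : 'cV[R]_n -> R) : gauss_measurable F -> gauss_measurable G ->
  (forall v, 0 <= F v) -> (forall v, F v <= G v) -> (gaussE F <= gaussE G)%E.
Proof.
move=> mF mG F0 FG; apply: ge0_le_integral => //.
- by move=> t _; rewrite lee_fin.
- exact/measurable_EFinP.
- exact/measurable_EFinP.
- by move=> t _; rewrite lee_fin.
Qed.

Lemma gaussE_lin n (F G : 'cV[R]_n -> R) a b : gauss_measurable F -> gauss_measurable G ->
  (forall v, 0 <= F v) -> (forall v, 0 <= G v) -> 0 <= a -> 0 <= b ->
  gaussE (fun v => a * F v + b * G v) = (a%:E * gaussE F + b%:E * gaussE G)%E.
Proof.
move=> mF mG F0 G0 a0 b0.
have mFE : measurable_fun [set: n.-tuple RB] (fun t => (F (col_tuple t))%:E).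
  exact/measurable_EFinP.
have mGE : measurable_fun [set: n.-tuple RB] (fun t => (G (col_tuple t))%:E).
  exact/measurable_EFinP.
have FE0 (t : n.-tuple RB) : setT t -> (0 <= (F (col_tuple t))%:E)%E.
  by rewrite lee_fin.
have GE0 (t : n.-tuple RB) : setT t -> (0 <= (G (col_tuple t))%:E)%E.
  by rewrite lee_fin.
rewrite /gaussE -(ge0_integralZl_EFin _ measurableT FE0 mFE a0).
rewrite -(ge0_integralZl_EFin _ measurableT GE0 mGE b0).
rewrite -ge0_integralD//.
- by move=> t _; rewrite mule_ge0// lee_fin.
- by apply: emeasurable_funM.
- by move=> t _; rewrite mule_ge0// lee_fin.
- by apply: emeasurable_funM.
Qed.

Definition convex_rfun n (F : 'cV[R]_n -> R) := forall t x y, 0 <= t <= 1 ->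
  F (t *: x + (1 - t) *: y) <= t * F x + (1 - t) * F y.

Definition gauss_admissible n (F : 'cV[R]_n -> R) :=
  [/\ gauss_measurable F, forall v, 0 <= F v & convex_rfun F].

(** This holds in particular when T g has the law of g; the interest lies in
    contractions T, which shrink the expectation of convex functions. *)
Definition gauss_dominated n (T : 'M[R]_n) := forall F, gauss_admissible F ->
  (gaussE (fun v => F (T *m v)) <= gaussE F)%E.

Lemma gauss_admissible_mul p n (T : 'M[R]_(p, n)) F :
  gauss_admissible F -> gauss_admissible (fun v => F (T *m v)).
Proof.
move=> [mF F0 cF]; split=> //; first exact: gauss_measurable_mul.
by move=> t x y t01; rewrite mulmxDr -!scalemxAr; exact: cF.
Qed.

Lemma vcons_lin n a b x y (v w : 'cV[R]_n) :
  a *: vcons x v + b *: vcons y w = vcons (a * x + b * y) (a *: v + b *: w).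
Proof.
apply/matrixP => i j; rewrite /vcons !mxE.
by case: splitP => k _; rewrite !mxE// [k]ord1 [j]ord1 eqxx.
Qed.

Lemma gauss_admissible_vcons n x (F : 'cV[R]_n.+1 -> R) :
  gauss_admissible F -> gauss_admissible (fun v => F (vcons x v)).
Proof.
move=> [mF F0 cF]; split=> //; first exact: gauss_measurable_vcons.
move=> t v w t01; rewrite (le_trans _ (cF _ _ _ t01))// vcons_lin.
by rewrite (_ : t * x + (1 - t) * x = x)//; ring.
Qed.

(** F \o S is again admissible, so that T can be removed first, then S. *)
Lemma gauss_dominated_mul n (S T : 'M[R]_n) :
  gauss_dominated S -> gauss_dominated T -> gauss_dominated (S *m T).
Proof.
move=> dS dT F aF; apply: le_trans (dS _ aF).
have := dT _ (gauss_admissible_mul S aF).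
by under eq_fun do rewrite mulmxA.
Qed.

Definition diag_block n (s : R) (T : 'M[R]_n) : 'M[R]_n.+1 :=
  block_mx (s%:M : 'M[R]_1) 0 0 T.

Lemma diag_block_vcons n s (T : 'M[R]_n) x v :
  diag_block s T *m vcons x v = vcons (s * x) (T *m v).
Proof.
apply: (etrans (mul_block_col (s%:M : 'M[R]_1) 0 0 T x%:M v)).
by rewrite !mul0mx addr0 add0r -scalar_mxM.
Qed.

(** Apply the hypothesis for each value of the first coordinate. *)
Lemma gauss_dominated_diag_block1 n (T : 'M[R]_n) :
  gauss_dominated T -> gauss_dominated (diag_block 1 T).
Proof.
move=> dT F aF; have [mF F0 cF] := aF.
have [mFT FT0 _] := gauss_admissible_mul (diag_block 1 T) aF.
rewrite !ge0_gaussE_vcons//; apply: ge0_le_integral => //.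
- by move=> x _; exact: gaussE_ge0.
- exact: (measurable_gaussE_vcons mFT).
- exact: (measurable_gaussE_vcons mF).
- move=> x _; under eq_fun do rewrite diag_block_vcons mul1r.
  exact: (dT _ (gauss_admissible_vcons x aF)).
Qed.

(** s x is the average of x and - x with weights (1 + s) / 2 and (1 - s) / 2,
    and the normal law is symmetric. *)
Lemma gauss_dominated_diag_block_scalar n (s : R) : -1 <= s <= 1 ->
  gauss_dominated (diag_block s (1%:M : 'M[R]_n)).
Proof.
move=> /andP[sN1 s1] F aF; have [mF F0 cF] := aF.
have [mFT FT0 _] := gauss_admissible_mul (diag_block s 1%:M) aF.
pose p := (1 + s) / 2; have p01 : 0 <= p <= 1 by rewrite /p; lra.
have /andP[p0 p1] := p01; have q0 : 0 <= 1 - p by rewrite subr_ge0.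
pose A x := gaussE (fun v => F (vcons x v)).
have mA : measurable_fun [set: RB] A by exact: measurable_gaussE_vcons.
have A0 x : (0 <= A x)%E by exact: gaussE_ge0.
have mAN : measurable_fun [set: RB] (fun x => A (- x)).
  by apply: (measurableT_comp mA); exact: measurable_funN.
have mpA : measurable_fun [set: RB] (fun x => p%:E * A x)%E.
  exact: emeasurable_funM.
have mqA : measurable_fun [set: RB] (fun x => (1 - p)%:E * A (- x)%R)%E.
  exact: emeasurable_funM.
have pA0 (x : RB) : setT x -> (0 <= p%:E * A x)%E by rewrite mule_ge0// lee_fin.
have qA0 (x : RB) : setT x -> (0 <= (1 - p)%:E * A (- x)%R)%E.
  by rewrite mule_ge0// lee_fin.
rewrite !ge0_gaussE_vcons//.
have -> : (\int[gamma]_x A x =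
    \int[gamma]_x (p%:E * A x + (1 - p)%:E * A (- x)%R))%E.
  rewrite (ge0_integralD _ measurableT pA0 mpA qA0 mqA).
  rewrite !ge0_integralZl_EFin// normal_integral_opp// -ge0_muleDl ?lee_fin//.
  by rewrite -EFinD addrC subrK mul1e.
apply: ge0_le_integral => //.
- by move=> x _; exact: gaussE_ge0.
- exact: (measurable_gaussE_vcons mFT).
- by apply: emeasurable_funD; exact: emeasurable_funM.
- move=> x _; rewrite -gaussE_lin//; try exact: gauss_measurable_vcons.
  apply: gaussE_le.
  + exact: (gauss_measurable_vcons x mFT).
  + by apply: measurable_funD; apply: measurable_funM => //;
      [exact: (gauss_measurable_vcons x mF)|exact: (gauss_measurable_vcons (- x) mF)].
  + by move=> v; exact: F0.
  + move=> v; rewrite diag_block_vcons mul1mx.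
    apply: le_trans (cF _ (vcons x v) (vcons (- x) v) p01).
    rewrite vcons_lin -scalerDl (_ : p + (1 - p) = 1) ?scale1r; last by ring.
    by rewrite (_ : p * x + (1 - p) * - x = s * x)// /p; field.
Qed.

Lemma diag_block_mul n s t (S T : 'M[R]_n) :
  diag_block s S *m diag_block t T = diag_block (s * t) (S *m T).
Proof.
apply: (etrans (mulmx_block (s%:M : 'M[R]_1) 0 0 S t%:M 0 0 T)).
by rewrite !mul0mx !mulmx0 !addr0 !add0r -scalar_mxM.
Qed.

Lemma gauss_dominated_diag_block n s (T : 'M[R]_n) : -1 <= s <= 1 ->
  gauss_dominated T -> gauss_dominated (diag_block s T).
Proof.
move=> s1 dT.
have -> : diag_block s T = diag_block s 1%:M *m diag_block 1 T.
  by rewrite diag_block_mul mulr1 mul1mx.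
by apply: gauss_dominated_mul;
  [exact: gauss_dominated_diag_block_scalar|exact: gauss_dominated_diag_block1].
Qed.

End contraction.

(** * The contraction principle *)

Section rotation.
Context {R : realType}.
Local Notation RB := (measurableTypeR R).
Local Notation gamma := (@normal_prob R 0 1).

(** Only the first two coordinates move, so that the claim is the plane case
    applied to the integral over the other coordinates. *)
Lemma gaussE_rotation m (c s : R) (F : 'cV[R]_m.+2 -> R) :
  c ^+ 2 + s ^+ 2 = 1 -> c != -1 -> gauss_measurable F -> (forall v, 0 <= F v) ->
  (\int[gamma]_x \int[gamma]_y
      gaussE (fun w => F (vcons (c * x - s * y)%R (vcons (s * x + c * y)%R w)))
   = gaussE F)%E.
Proof.
move=> cs1 cN1 mF F0.
pose K z t := (F (vcons z.1 (vcons z.2 (col_tuple t)))).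
have mK : measurable_fun [set: (RB * RB) * m.-tuple RB] (fun z => (K z.1 z.2)%:E).
  apply/measurable_EFinP.
  have mc : measurable_fun [set: (RB * RB) * m.-tuple RB]
      (fun z => tuple_consp (z.1.1, tuple_consp (z.1.2, z.2))).
    apply: (measurableT_comp (@measurable_tuple_consp R m.+1)).
    apply: measurable_fun_pair.
      exact: (measurableT_comp measurable_fst measurable_fst).
    apply: (measurableT_comp (@measurable_tuple_consp R m)).
    apply: measurable_fun_pair; last exact: measurable_snd.
    exact: (measurableT_comp measurable_snd measurable_fst).
  have := measurableT_comp mF mc.
  by congr measurable_fun; apply/funext => -[[x y] t] /=; rewrite !col_tuple_consp.
pose G (z : RB * RB) := gaussE (fun w => F (vcons z.1 (vcons z.2 w))).
have mG : measurable_fun setT G.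
  apply: (measurable_fun_fubini_tonelli_F (m2 := std_gaussian m) _ mK).
  by move=> z; rewrite lee_fin; exact: F0.
have G0 z : (0 <= G z)%E by apply: gaussE_ge0 => w; exact: F0.
apply: (etrans (normal_integral_rotation cs1 cN1 mG G0)).
apply/esym/(etrans (ge0_gaussE_vcons mF F0)); apply: eq_integral => x _.
by apply: (etrans (ge0_gaussE_vcons (gauss_measurable_vcons x mF) _)).
Qed.

Definition rot_mx m (c s : R) : 'M[R]_m.+2 :=
  block_mx (c%:M : 'M[R]_1) (row_mx (- s)%:M 0) (col_mx s%:M 0)
    (diag_block c (1%:M : 'M[R]_m)).

Lemma rot_mx_vcons m c s x y (w : 'cV[R]_m) :
  rot_mx m c s *m vcons x (vcons y w)
  = vcons (c * x - s * y) (vcons (s * x + c * y) w).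
Proof.
apply: (etrans (mul_block_col (c%:M : 'M[R]_1) _ _ _ x%:M (vcons y w))).
congr col_mx.
  rewrite -scalar_mxM (mul_row_col _ _ y%:M w) mul0mx addr0.
  by rewrite -scalar_mxM -raddfD /= mulNr.
have e1 : col_mx (s%:M : 'M[R]_1) (0 : 'cV[R]_m) *m x%:M = vcons (s * x) 0.
  by rewrite mul_col_mx mul0mx -scalar_mxM.
apply: (etrans (congr1 (fun v => v + _) e1)); rewrite diag_block_vcons mul1mx.
have /= := @vcons_lin R m 1 1 (s * x) (c * y) 0 w.
by rewrite !scale1r !mul1r add0r.
Qed.

Lemma tr_diag_block n s (T : 'M[R]_n) : (diag_block s T)^T = diag_block s T^T.
Proof.
apply: (etrans (tr_block_mx (s%:M : 'M[R]_1) 0 0 T)).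
by rewrite !trmx0 tr_scalar_mx.
Qed.

Lemma tr_rot_mx m c s : (rot_mx m c s)^T = rot_mx m c (- s).
Proof.
apply: (etrans (tr_block_mx (c%:M : 'M[R]_1) _ _ _)).
rewrite (tr_row_mx (_ : 'M[R]_1)) (tr_col_mx (_ : 'M[R]_1)) tr_diag_block.
by rewrite !tr_scalar_mx !trmx0 /rot_mx opprK.
Qed.

Lemma vconsP n (u : 'cV[R]_n.+1) : exists a w, u = vcons a w.
Proof.
exists (u ord0 ord0), (dsubmx (u : 'cV_(1 + n))).
apply/matrixP => i j; rewrite /vcons [j]ord1 !mxE.
case: splitP => k ik; rewrite !mxE; last by congr (u _ _); exact: val_inj.
by rewrite [k]ord1 in ik *; rewrite eqxx; congr (u _ _); exact: val_inj.
Qed.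

Lemma vcons00 n : vcons 0 0 = 0 :> 'cV[R]_n.+1.
Proof. by have := @vcons_lin R n 0 0 0 0 0 0; rewrite !scale0r !mul0r !addr0. Qed.

Lemma dot_vcons n x y (v w : 'cV[R]_n) :
  dot (vcons x v) (vcons y w) = x * y + dot v w.
Proof.
rewrite /dot (@big_split_ord _ _ _ 1 n) big_ord1 /=.
rewrite !(@col_mxEu R 1 n 1) !mxE; congr (_ + _).
by apply: eq_bigr => i _; rewrite !(@col_mxEd R 1 n 1).
Qed.

Lemma eq_mulmx_vec n (A B : 'M[R]_n) : (forall v : 'cV_n, A *m v = B *m v) -> A = B.
Proof.
move=> AB; apply/matrixP => i j; have := AB (delta_mx j 0).
by rewrite -!colE => /matrixP/(_ i 0); rewrite !mxE.
Qed.

Lemma rot_mxK m c s : c ^+ 2 + s ^+ 2 = 1 ->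
  rot_mx m c (- s) *m rot_mx m c s = 1%:M.
Proof.
move=> cs1; apply: eq_mulmx_vec => v; rewrite mul1mx -mulmxA.
have [x [v' ->]] := vconsP v; have [y [w ->]] := vconsP v'.
rewrite !rot_mx_vcons; congr (vcons _ (vcons _ _)).
  transitivity ((c ^+ 2 + s ^+ 2) * x); first by ring.
  by rewrite cs1 mul1r.
transitivity ((c ^+ 2 + s ^+ 2) * y); first by ring.
by rewrite cs1 mul1r.
Qed.

Lemma gauss_dominated_rot m c s : c ^+ 2 + s ^+ 2 = 1 -> c != -1 ->
  gauss_dominated (rot_mx m c s).
Proof.
move=> cs1 cN1 F aF; have [mF F0 _] := aF.
have [mFT FT0 _] := gauss_admissible_mul (rot_mx m c s) aF.
rewrite -(gaussE_rotation cs1 cN1 mF F0) le_eqVlt; apply/orP; left; apply/eqP.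
apply: (etrans (ge0_gaussE_vcons mFT FT0)); apply: eq_integral => x _.
have mFTx := gauss_measurable_vcons x mFT.
apply: (etrans (ge0_gaussE_vcons mFTx (fun v => FT0 (vcons x v)))).
apply: eq_integral => y _; congr gaussE; apply/funext => w.
by rewrite rot_mx_vcons.
Qed.

(** Write u = (a, w). By induction some A carries w / |w| to the first basis
    vector of the smaller space, so that diag(1, A) carries u to
    (a, |w|, 0); the rotation with cosine a and sine - |w| then carries this to
    (1, 0, 0). *)
Lemma rotate_to_first m (u : 'cV[R]_m.+1) : enorm u = 1 ->
  exists U : 'M[R]_m.+1, [/\ U^T *m U = 1%:M, gauss_dominated U,
    gauss_dominated U^T & U *m u = vcons 1 0].
Proof.
elim: m u => [|m IH] u u1; have [a [w uE]] := vconsP u;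
  have aw1 : a * a + dot w w = 1 by
    rewrite -dot_vcons -uE -enorm_sqr u1 expr1n.
(* If u is on the first axis, a sign suffices; this is the only case in
   dimension one. *)
all: have [w0|wn0] := eqVneq w 0; first (
  rewrite w0 dot0l addr0 in aw1; exists (diag_block a 1%:M); split;
  [ by rewrite tr_diag_block diag_block_mul trmx1 mul1mx aw1 /diag_block -scalar_mx_block
  | apply: gauss_dominated_diag_block_scalar; nra
  | rewrite tr_diag_block trmx1; apply: gauss_dominated_diag_block_scalar; nra
  | by rewrite uE w0 diag_block_vcons aw1 mulmx0 ] ).
  by case/eqP: wn0; exact: flatmx0.
have n0 : enorm w != 0 by rewrite enorm_eq0.
have [A [AA dA dAT Aw]] : exists A : 'M[R]_m.+1, [/\ A^T *m A = 1%:M,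
    gauss_dominated A, gauss_dominated A^T & A *m ((enorm w)^-1 *: w) = vcons 1 0].
  by apply: IH; rewrite enormZ ger0_norm ?invr_ge0 ?enorm_ge0// mulVf.
have cs1 : a ^+ 2 + (- enorm w) ^+ 2 = 1 by rewrite sqrrN enorm_sqr expr2.
(* Here w != 0 excludes the half turn. *)
have cN1 : a != -1.
  apply/eqP => aE; move: cs1; rewrite aE !sqrrN expr1n -[RHS]addr0.
  by move/addrI/eqP; rewrite sqrf_eq0 (negbTE n0).
exists (rot_mx m a (- enorm w) *m diag_block 1 A); split.
- rewrite trmx_mul tr_rot_mx tr_diag_block mulmxA.
  rewrite -(mulmxA _ (rot_mx m a (- - enorm w))) (rot_mxK m cs1) mulmx1.
  by rewrite diag_block_mul AA mulr1 /diag_block -scalar_mx_block.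
- by apply: gauss_dominated_mul;
  [exact: gauss_dominated_rot|exact: gauss_dominated_diag_block1].
- rewrite trmx_mul tr_rot_mx tr_diag_block; apply: gauss_dominated_mul.
    exact: gauss_dominated_diag_block1.
  by apply: gauss_dominated_rot => //; rewrite sqrrN.
- have -> : u = vcons a (enorm w *: ((enorm w)^-1 *: w)).
    by rewrite scalerA divff// scale1r.
  rewrite -mulmxA diag_block_vcons -scalemxAr Aw.
  have -> : enorm w *: vcons 1 0 = vcons (enorm w) (0 : 'cV[R]_m).
    have := @vcons_lin R m (enorm w) 0 1 0 0 0.
    by rewrite !scale0r !mulr0 mulr1 scaler0 !addr0.
  rewrite mul1r rot_mx_vcons -vcons00; congr (vcons _ (vcons _ _)).
    by rewrite -[RHS]cs1; ring.
  by ring.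
Qed.

End rotation.

Section contraction_principle.
Context {R : realType}.

Lemma orthogonal_enorm n (U : 'M[R]_n) v : U^T *m U = 1%:M ->
  enorm (U *m v) = enorm v.
Proof.
move=> UU; apply/eqP; rewrite -(@eqrXn2 _ 2) ?enorm_ge0//.
by rewrite !enorm_sqr dot_mulmx mulmxA UU mul1mx.
Qed.

Lemma max_stretch m (T : 'M[R]_m.+1) :
  exists2 x, enorm x = 1 & forall z, enorm (T *m z) <= enorm (T *m x) * enorm z.
Proof.
have [M M0 TM] := mulmx_bounded T.
have e1 : enorm (vcons 1 0 : 'cV[R]_m.+1) = 1.
  apply/eqP; rewrite -(@eqrXn2 _ 2) ?enorm_ge0// enorm_sqr dot_vcons.
  by rewrite dot0l mul1r addr0 expr1n.
have clS : closed [set x : 'cV[R]_m.+1 | enorm x = 1].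
  have : closed ((@enorm R m.+1) @^-1` [set 1]); last by [].
  apply: closed_comp; last exact: closed_eq.
  move=> x _; apply: (@lipschitz_enorm_continuous _ _ _ 1) => y z.
  by rewrite mul1r; exact: enorm_dist_lip.
have [||x y|x x1 xmax] := bounded_closed_argmin (M := 1) (L := M)
    (f := fun x => - enorm (T *m x)) _ clS.
- by exists (vcons 1 0).
- by move=> x ->.
- rewrite opprK addrC (le_trans (enorm_dist_lip _ _))// -mulmxBr.
  by rewrite enorm_distC; exact: TM.
exists x => // z; have [->|z0] := eqVneq z 0.
  by rewrite mulmx0 !enorm0 mulr0.
have nz : enorm z != 0 by rewrite enorm_eq0.
have := xmax ((enorm z)^-1 *: z).
rewrite /= lerN2 -scalemxAr !enormZ ger0_norm ?invr_ge0 ?enorm_ge0// mulVf//.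
by move=> /(_ erefl); rewrite mulrC ler_pdivrMr// lt_def nz enorm_ge0.
Qed.

(** Let (s, b) be the first row of M. If b != 0, the vector (s, b) would be
    stretched by more than s, since the first entry of its image is s^2 + |b|^2. *)
Lemma diag_block_of_max_stretch m (M : 'M[R]_m.+1) s : 0 <= s ->
  M *m vcons 1 0 = vcons s 0 ->
  (forall z, enorm (M *m z) <= s * enorm z) ->
  exists2 T, M = diag_block s T & forall v, enorm (T *m v) <= s * enorm v.
Proof.
move=> s0 Me Ms.
pose M' := M : 'M[R]_(1 + m); pose b := ursubmx M'; pose T := drsubmx M'.
have ME x v : M *m vcons x v = vcons (s * x + dot b^T v) (T *m v).
  have -> : vcons x v = x *: vcons 1 0 + vcons 0 v.
    have := @vcons_lin R m x 1 1 0 0 v.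
    by rewrite mulr1 mulr0 addr0 scaler0 add0r !scale1r => ->.
  rewrite mulmxDr -scalemxAr Me.
  have -> : M *m vcons 0 v = vcons (dot b^T v) (T *m v).
    rewrite -[M]/M' -(submxK M').
    apply: (etrans (mul_block_col (ulsubmx M') b (dlsubmx M') T 0%:M v)).
    have -> : 0%:M = 0 :> 'M[R]_1 by exact: raddf0.
    rewrite !mulmx0 !add0r; congr col_mx.
    rewrite [LHS]mx11_scalar; congr (_%:M); rewrite mxE.
    by apply: eq_bigr => i _; rewrite !mxE.
  have := @vcons_lin R m x 1 s (dot b^T v) 0 (T *m v).
  by rewrite !scale1r scaler0 add0r mul1r (mulrC x) => ->.
have b0 : b = 0.
  apply/eqP; rewrite -trmx_eq0 -enorm_eq0; apply/eqP.
  have := Ms (vcons s b^T); rewrite ME.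
  rewrite -ler_sqr ?nnegrE ?mulr_ge0 ?enorm_ge0// exprMn !enorm_sqr !dot_vcons.
  rewrite -enorm_sqr => h; apply/eqP; rewrite -sqrf_eq0 eq_le sqr_ge0 andbT.
  have := dot_ge0 (T *m b^T); have := sqr_ge0 (enorm b^T).
  move: h; set q := enorm _ ^+ 2; set d := dot _ _ => h q0 d0.
  have hq : q * (s ^+ 2 + q) <= 0.
    by move: h; rewrite -subr_le0 => h; nra.
  by have := sqr_ge0 s; nra.
exists T.
  apply: eq_mulmx_vec => v; have [x [w ->]] := vconsP v.
  by rewrite ME diag_block_vcons b0 trmx0 dot0l addr0.
move=> v; have := Ms (vcons 0 v); rewrite ME b0 trmx0 dot0l mulr0 addr0.
have e0 (w : 'cV[R]_m) : enorm (vcons 0 w) = enorm w.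
  apply/eqP; rewrite -(@eqrXn2 _ 2) ?enorm_ge0// !enorm_sqr dot_vcons.
  by rewrite mulr0 add0r.
by rewrite !e0.
Qed.

(** The singular value decomposition, one singular value at a time: the factors
    U and V below bring T to the form diag(s, T'). *)
Lemma gauss_dominated_contraction n (T : 'M[R]_n) :
  (forall v, enorm (T *m v) <= enorm v) -> gauss_dominated T.
Proof.
elim: n T => [|m IH] T T1.
  move=> F aF; rewrite le_eqVlt; apply/orP; left; apply/eqP.
  by congr gaussE; apply/funext => v; congr F; rewrite [RHS]flatmx0 [LHS]flatmx0.
have [x x1 xmax] := max_stretch T; set s := enorm (T *m x) in xmax.
have s0 : 0 <= s by exact: enorm_ge0.
have s1 : s <= 1 by rewrite -x1; exact: T1.
(* If s = 0, any unit vector y will do. *)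
have [y y1 Ty] : exists2 y, enorm y = 1 & T *m x = s *: y.
  have [sE|sn0] := eqVneq s 0.
    by exists x => //; rewrite sE scale0r; apply/eqP; rewrite -enorm_eq0 -/s sE.
  exists (s^-1 *: (T *m x)); last by rewrite scalerA divff// scale1r.
  by rewrite enormZ ger0_norm ?invr_ge0// -/s mulVf.
have [V [VV dV dVT Vx]] := rotate_to_first x1.
have [U [UU dU dUT Uy]] := rotate_to_first y1.
have VV' := mulmx1C VV.
have [|z|T' ME T's] := @diag_block_of_max_stretch m (U *m T *m V^T) s s0.
- rewrite -mulmxA -Vx (mulmxA V^T) VV mul1mx -mulmxA Ty -scalemxAr Uy.
  have := @vcons_lin R m s 0 1 0 0 0.
  by rewrite !scale0r !mulr0 mulr1 scaler0 !addr0.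
- rewrite -!mulmxA orthogonal_enorm// (le_trans (xmax _))// orthogonal_enorm//.
  by rewrite trmxK.
have -> : T = U^T *m diag_block s T' *m V.
  by rewrite -ME !mulmxA UU mul1mx -mulmxA VV mulmx1.
apply: gauss_dominated_mul => //; apply: gauss_dominated_mul => //.
apply: gauss_dominated_diag_block; first by rewrite s1 andbT (le_trans _ s0)// oppr_le0.
by apply: IH => v; rewrite (le_trans (T's v))// ler_piMl// enorm_ge0.
Qed.

End contraction_principle.

(** * Projections onto closed convex cones and statistical dimension *)

Section lipschitz_measurable.
Context {R : realType}.
Local Notation RB := (measurableTypeR R).

(** {F > a} is the union over rational q of the l^1-balls of centre q and radius
    F q - a: these lie in {F > a} because F is 1-Lipschitz, and they cover it
    because rational points are dense. *)
Lemma gauss_measurable_lipschitz n (F : 'cV[R]_n -> R) :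
  (forall x y, `|F x - F y| <= enorm (x - y)) -> gauss_measurable F.
Proof.
move=> FL mD; apply: (measurability _ (RGenOInfty.measurableE R)) => //.
move=> /= _ [_ [a ->] <-]; rewrite setTI preimage_itvoy.
pose qv (q : 'cV[rat]_n) : 'cV[R]_n := map_mx ratr q.
pose N (x : 'cV[R]_n) := \sum_i `|x i ord0|.
have FN x y : `|F x - F y| <= N (x - y).
  exact: le_trans (FL x y) (enorm_le_sum _).
rewrite [X in measurable X](_ : _ = \bigcup_(q : 'cV[rat]_n)
    [set t : n.-tuple RB | N (col_tuple t - qv q) < F (qv q) - a]).
  apply: countable_bigcupT_measurable => //.
  move=> q.
  have mN : measurable_fun [set: n.-tuple RB] (fun t => N (col_tuple t - qv q)).
    apply: measurable_sum => i; apply: measurableT_comp => //.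
    under eq_fun do rewrite !mxE.
    by apply: measurable_funB => //; exact: measurable_tnth.
  have := mN measurableT _ (measurable_itv `]-oo, (F (qv q) - a)[).
  by rewrite setTI; congr measurable; apply/seteqP; split=> t /=; rewrite in_itv.
apply/seteqP; split=> [t /= Fa|t [q _ /=] Nq]; last first.
  by have := FN (col_tuple t) (qv q); rewrite ler_norml => /andP[]; lra.
(* A rational point at distance less than e has a ball that contains the
   point t, because F varies by less than e between the two. *)
pose e := (F (col_tuple t) - a) / 2; have e0 : 0 < e by rewrite /e; lra.
have e1 : 0 < e / n.+1%:R by rewrite divr_gt0.
have rat_near (x : R) : exists q : rat, `|x - ratr q| < e / n.+1%:R.
  move: (_ / _) e1 => d d0; have /rat_in_itvoo[q] : x - d < x + d by lra.
  rewrite inE /= => /itvP h; exists q; rewrite ltr_norml.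
  have q1 : x - d < ratr q by rewrite h.
  have q2 : ratr q < x + d by rewrite h.
  by apply/andP; split; lra.
pose q : 'cV[rat]_n := \col_i sval (cid (rat_near (tnth t i))).
have Nq : N (col_tuple t - qv q) < e.
  apply: (@le_lt_trans _ _ (\sum_(i < n) e / n.+1%:R)).
    by apply: ler_sum => i _; rewrite !mxE; apply/ltW; case: cid.
  rewrite sumr_const card_ord -[ltLHS]mulr_natr -mulrA gtr_pMr//.
  by rewrite mulrC ltr_pdivrMr// mul1r ltr_nat.
exists q => //=; have := FN (col_tuple t) (qv q); rewrite ler_norml => /andP[].
by rewrite /e in Nq; lra.
Qed.

End lipschitz_measurable.

Section cone_projection.
Context {R : realType}.

Definition closed_convex_cone n (C : set 'cV[R]_n) :=
  [/\ C 0, forall x y, C x -> C y -> C (x + y),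
      forall a x, 0 <= a -> C x -> C (a *: x) & closed C].

Definition pnorm n (C : set 'cV[R]_n) x := enorm (euclid_proj C x).

Lemma euclid_projP n (C : set 'cV[R]_n) x : closed_convex_cone C ->
  C (euclid_proj C x) /\
  forall z, C z -> enorm (x - euclid_proj C x) <= enorm (x - z).
Proof.
move=> [C0 _ _ clC].
apply: (@xgetPex _ 0 [set y | C y /\ forall z, C z -> enorm (x - y) <= enorm (x - z)]).
have dist_lip (y w : 'cV[R]_n) :
    `|enorm (x - y) - enorm (x - w)| <= enorm (y - w).
  rewrite (le_trans (enorm_dist_lip _ _))// opprB addrC addrA subrK.
  by rewrite enorm_distC.
have clB : closed [set z : 'cV[R]_n | enorm (x - z) <= enorm x].
  have : closed ((fun z : 'cV[R]_n => enorm (x - z)) @^-1` [set t | t <= enorm x]);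
    last by [].
  apply: closed_comp; last exact: closed_le.
  move=> z _; apply: (@lipschitz_enorm_continuous _ _ _ 1) => y w.
  by rewrite mul1r; exact: dist_lip.
have [||z w|p [Cp px] pmin] := @bounded_closed_argmin R n
    (C `&` [set z | enorm (x - z) <= enorm x]) (enorm x + enorm x) 1
    (fun z => enorm (x - z)) _ (closedI clC clB).
- by exists 0; split => //=; rewrite subr0.
- move=> z [_ /= zx].
  have := enormD (z - x) x; rewrite subrK enorm_distC => /le_trans; apply.
  by rewrite lerD2r.
- by rewrite mul1r; exact: dist_lip.
exists p; split=> // z Cz.
have [zx|/ltW xz] := leP (enorm (x - z)) (enorm x); first exact: pmin.
exact: le_trans px xz.
Qed.

Section projection.
Variables (n : nat) (C : set 'cV[R]_n).
Hypothesis Ccone : closed_convex_cone C.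

Lemma euclid_proj_in x : C (euclid_proj C x).
Proof. by have [] := euclid_projP x Ccone. Qed.

(** First-order optimality of the nearest point along a segment that
    stays in C. *)
Lemma euclid_proj_variation x z :
  (forall t, 0 <= t <= 1 -> C (euclid_proj C x + t *: z)) ->
  dot (x - euclid_proj C x) z <= 0.
Proof.
move=> Cz; rewrite leNgt; apply/negP => d0.
have [_ pmin] := euclid_projP x Ccone.
set p := euclid_proj C x in Cz d0 pmin *; set d := dot _ _ in d0.
(* The quadratic - 2 t d + t^2 q in t is negative at this t <= 1. *)
pose q := dot z z; have q0 : 0 <= q by exact: dot_ge0.
have D0 : 0 < q + d + 1 by lra.
pose t := d / (q + d + 1); have t0 : 0 < t by rewrite divr_gt0.
have tD : t * (q + d + 1) = d by rewrite /t divfK// gt_eqF.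
have t1 : 0 <= t <= 1 by rewrite ltW//= ler_pdivrMr//; lra.
have := pmin _ (Cz _ t1); rewrite -ler_sqr ?nnegrE ?enorm_ge0//.
have -> : enorm (x - (p + t *: z)) ^+ 2
    = enorm (x - p) ^+ 2 - t * (2 * d) + t * (t * q).
  rewrite opprD addrA /d /q; move: (x - p) => u.
  by rewrite !enorm_sqr dotBl !dotBr !dotZl !dotZr (dotC z u); ring.
move=> h; have {}h : t * (2 * d) <= t * (t * q) by lra.
by move: h; rewrite ler_pM2l// => h; nra.
Qed.

Lemma euclid_proj_polar x z : C z -> dot x z <= dot (euclid_proj C x) z.
Proof.
move=> Cz; rewrite -subr_le0 -dotBl; apply: euclid_proj_variation => t /andP[t0 _].
by have [_ CD CZ _] := Ccone; apply: CD; [exact: euclid_proj_in|exact: CZ].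
Qed.

(** The variations along p and along - p, where p is the projection of x, show
    that x - p is orthogonal to p. *)
Lemma pnorm_sqr x : pnorm C x ^+ 2 = dot x (euclid_proj C x).
Proof.
rewrite /pnorm enorm_sqr; apply/eqP.
rewrite eq_le (euclid_proj_polar x (euclid_proj_in x)) andbT.
rewrite -subr_ge0 -dotBl -oppr_le0 -dotNr.
apply: euclid_proj_variation => t /andP[t0 t1].
rewrite scalerN -{1}[euclid_proj C x]scale1r -scalerBl.
by have [_ _ CZ _] := Ccone; apply: CZ; [rewrite subr_ge0|exact: euclid_proj_in].
Qed.

Lemma pnorm_ge0 x : 0 <= pnorm C x. Proof. exact: enorm_ge0. Qed.

Lemma dot_le_pnorm x z : C z -> dot x z <= pnorm C x * enorm z.
Proof.
by move=> Cz; apply: le_trans (euclid_proj_polar x Cz) _; exact: cauchy_schwarz.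
Qed.

(** Test the hypothesis at z = euclid_proj C x, where <x, z> = |z|^2. *)
Lemma pnorm_le x L : 0 <= L -> (forall z, C z -> dot x z <= L * enorm z) ->
  pnorm C x <= L.
Proof.
move=> L0 xL; have [->//|p0] := eqVneq (pnorm C x) 0.
have pp : 0 < pnorm C x by rewrite lt_def p0 pnorm_ge0.
by rewrite -(ler_pM2r pp) -expr2 pnorm_sqr; exact: xL (euclid_proj_in x).
Qed.

Lemma pnorm_le_enorm x : pnorm C x <= enorm x.
Proof. by apply: pnorm_le => [|z _]; [exact: enorm_ge0|exact: cauchy_schwarz]. Qed.

Lemma pnormZ_le a x : 0 <= a -> pnorm C (a *: x) <= a * pnorm C x.
Proof.
move=> a0; apply: pnorm_le => [|z Cz]; first by rewrite mulr_ge0 ?pnorm_ge0.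
by rewrite dotZl -mulrA ler_wpM2l// dot_le_pnorm.
Qed.

Lemma pnorm_lipschitz x y : `|pnorm C x - pnorm C y| <= enorm (x - y).
Proof.
have h u v : pnorm C u <= pnorm C v + enorm (u - v).
  apply: pnorm_le => [|z Cz]; first by rewrite addr_ge0 ?enorm_ge0.
  rewrite -{1}[u](subrK v) addrC dotDl mulrDl lerD ?dot_le_pnorm//.
  exact: cauchy_schwarz.
have h1 := h x y; have := h y x; rewrite enorm_distC => h2.
by rewrite ler_norml; apply/andP; split; lra.
Qed.

Lemma pnorm_convex : convex_rfun (pnorm C).
Proof.
move=> t x y /andP[t0 t1]; have t1' : 0 <= 1 - t by rewrite subr_ge0.
apply: pnorm_le => [|z Cz]; first by rewrite addr_ge0// mulr_ge0 ?pnorm_ge0.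
by rewrite dotDl !dotZl [leRHS]mulrDl -!mulrA lerD// ler_wpM2l// dot_le_pnorm.
Qed.

Lemma gauss_admissible_pnorm_sqr : gauss_admissible (fun v => pnorm C v ^+ 2).
Proof.
split=> [|v|t x y t01]; last 1 first.
- apply: (@le_trans _ _ ((t * pnorm C x + (1 - t) * pnorm C y) ^+ 2)).
    have := pnorm_convex x y t01; have /andP[t0 t1] := t01.
    by rewrite ler_sqr ?nnegrE ?pnorm_ge0// addr_ge0 ?mulr_ge0 ?pnorm_ge0 ?subr_ge0.
  rewrite -subr_ge0; set a := pnorm C x; set b := pnorm C y.
  rewrite (_ : _ - _ = t * (1 - t) * (a - b) ^+ 2); last by ring.
  by have /andP[t0 t1] := t01; apply: mulr_ge0 (sqr_ge0 _); rewrite mulr_ge0 ?subr_ge0.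
- apply: measurable_funX; apply: gauss_measurable_lipschitz.
  exact: pnorm_lipschitz.
- exact: sqr_ge0.
Qed.

End projection.

Lemma statdimE n (C : set 'cV[R]_n) : statdim C = gaussE (fun v => pnorm C v ^+ 2).
Proof. by rewrite /statdim unlock. Qed.

Lemma statdim_ge0 n (C : set 'cV[R]_n) : (0 <= statdim C)%E.
Proof. by rewrite statdimE; apply: gaussE_ge0 => v; exact: sqr_ge0. Qed.

Lemma statdim_eq0_of_trivial n (P : set 'cV[R]_n) : closed_convex_cone P ->
  (forall x, P x -> x = 0) -> statdim P = 0%E.
Proof.
move=> Pc P0; rewrite statdimE /gaussE; apply: integral0_eq => t _.
by rewrite /pnorm (P0 _ (euclid_proj_in Pc _)) enorm0 expr0n.
Qed.

(** Apply the contraction principle to B / s and the convex function h_C^2. *)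
Lemma statdim_le n (K C : set 'cV[R]_n) (B : 'M[R]_n) L s :
  closed_convex_cone K -> closed_convex_cone C -> 0 <= L -> 0 < s ->
  (forall x, pnorm K x <= L * pnorm C (B *m x)) ->
  (forall x, enorm (B *m x) <= s * enorm x) ->
  (statdim K <= ((L * s) ^+ 2)%:E * statdim C)%E.
Proof.
move=> Kc Cc L0 s0 KC Bs; rewrite !statdimE.
have [mK K0 _] := gauss_admissible_pnorm_sqr Kc.
have aC := gauss_admissible_pnorm_sqr Cc; have [mC C0 _] := aC.
have sV0 : 0 <= s^-1 by rewrite invr_ge0 ltW.
have dB : gauss_dominated (s^-1 *: B).
  apply: gauss_dominated_contraction => v.
  by rewrite -scalemxAl enormZ ger0_norm// mulrC ler_pdivrMr// mulrC.
have [mB B0 _] := gauss_admissible_mul (s^-1 *: B) aC.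
apply: (@le_trans _ _ (((L * s) ^+ 2)%:E *
    gaussE (fun v => (pnorm C ((s^-1 *: B) *m v) ^+ 2)%R))%E); last first.
  by apply: lee_wpmul2l; [rewrite lee_fin sqr_ge0|exact: (dB _ aC)].
rewrite -ge0_integralZl_EFin ?sqr_ge0//; last 2 first.
- by move=> t _; rewrite lee_fin.
- exact/measurable_EFinP.
apply: ge0_le_integral => //.
- by move=> t _; rewrite lee_fin.
- exact/measurable_EFinP.
- by apply: emeasurable_funM => //; exact/measurable_EFinP.
move=> t _; rewrite -EFinM lee_fin -exprMn ler_sqr ?nnegrE ?mulr_ge0 ?pnorm_ge0 ?(ltW s0)//.
apply: le_trans (KC _) _; rewrite -mulrA ler_wpM2l//.
have {1}-> : B *m col_tuple t = s *: ((s^-1 *: B) *m col_tuple t).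
  by rewrite -scalemxAl scalerA divff ?scale1r// gt_eqF.
by apply: pnormZ_le => //; exact: ltW.
Qed.

End cone_projection.

(** * Descent cones and linear maps *)

Section cone_maps.
Context {R : realType}.

Lemma mulmx_continuous p n (A : 'M[R]_(p, n)) :
  continuous (fun x : 'cV[R]_n => A *m x).
Proof.
have [M M0 AM] := mulmx_bounded A.
move=> x B /nbhs_enormP[e e0 eB]; apply/nbhs_enormP.
exists (e / M) => [|y]; first by rewrite divr_gt0.
rewrite ltr_pdivlMr// mulrC => xy; apply: eB; rewrite -mulmxBr.
exact: le_lt_trans (AM _) xy.
Qed.

(** For z in K one has <x, z> = <B^T x, A z> <= h_C (B^T x) L |z|. *)
Lemma statdim_le_of_map n (K C : set 'cV[R]_n) (A B : 'M[R]_n) L s :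
  closed_convex_cone K -> closed_convex_cone C -> B *m A = 1%:M ->
  (forall z, K z -> C (A *m z)) -> 0 <= L -> 0 < s ->
  (forall z, K z -> enorm (A *m z) <= L * enorm z) ->
  (forall x, enorm (B *m x) <= s * enorm x) ->
  (statdim K <= ((L * s) ^+ 2)%:E * statdim C)%E.
Proof.
move=> Kc Cc BA KC L0 s0 AL Bs.
apply: (statdim_le (B := B^T)) => // [x|]; last first.
  exact: trmx_contraction (ltW s0) Bs.
apply: pnorm_le => // [|z Kz]; first by rewrite mulr_ge0// pnorm_ge0.
rewrite -[z in dot _ z]mul1mx -BA -mulmxA dotC dot_mulmx dotC.
apply: le_trans (dot_le_pnorm Cc _ (KC _ Kz)) _.
by rewrite (mulrC L) -mulrA ler_wpM2l ?pnorm_ge0// AL.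
Qed.

Lemma closed_convex_cone_closure n (A : set 'cV[R]_n) :
  A 0 -> (forall x y, A x -> A y -> A (x + y)) ->
  (forall a x, 0 < a -> A x -> A (a *: x)) -> closed_convex_cone (closure A).
Proof.
move=> A0 AD AZ; split; last exact: closed_closure.
- exact: subset_closure.
- move=> x y /closure_enormP clx /closure_enormP cly.
  apply/closure_enormP => e e0; have e2 : 0 < e / 2 by rewrite divr_gt0.
  have [x' Ax' xx'] := clx _ e2; have [y' Ay' yy'] := cly _ e2.
  exists (x' + y'); first exact: AD.
  rewrite opprD addrACA (le_lt_trans (enormD _ _))//.
  by rewrite [ltRHS]splitr ltrD.
- move=> a x; rewrite le_eqVlt => /predU1P[<- _|a0 /closure_enormP clx].
    by rewrite scale0r; exact: subset_closure.
  apply/closure_enormP => e e0.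
  have [y Ay xy] := clx _ (divr_gt0 e0 a0); exists (a *: y); first exact: AZ.
  by rewrite -scalerBr enormZ gtr0_norm// mulrC -ltr_pdivlMr.
Qed.

(** The sublevel set {f <= f x} is convex, and x belongs to it. *)
Lemma convex_efun_segment n (f : 'cV[R]_n -> \bar R) x y (s t : R) :
  (forall x, f x != -oo%E) -> convex_efun f -> 0 < t -> 0 <= s <= t ->
  (f (x + t *: y)%R <= f x)%E -> (f (x + s *: y)%R <= f x)%E.
Proof.
move=> fNy cf t0 /andP[s0 st] fxy.
have r0 : 0 <= s / t by rewrite divr_ge0// ltW.
have r1 : s / t <= 1 by rewrite ler_pdivrMr// mul1r.
have r01 : 0 <= s / t <= 1 by rewrite r0.
have := cf (s / t) (x + t *: y) x r01.
have -> : (s / t) *: (x + t *: y) + (1 - s / t) *: x = x + s *: y.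
  rewrite scalerDr scalerA divfK ?gt_eqF// addrAC -scalerDl.
  by rewrite (_ : s / t + (1 - s / t) = 1) ?scale1r// addrC subrK.
move=> /le_trans; apply.
case fxE : (f x) fxy => [c||] fxy; last by move: (fNy x); rewrite fxE.
- apply: (@le_trans _ _ ((s / t)%:E * c%:E + (1 - s / t)%R%:E * c%:E)%E).
    by apply: leeD => //; apply: lee_wpmul2l => //; rewrite lee_fin.
  rewrite -!EFinM -EFinD lee_fin -mulrDl (_ : s / t + (1 - s / t) = 1) ?mul1r//.
  by rewrite addrC subrK.
- exact: leey.
Qed.

(** For the sum of two descent directions, take the midpoint of the two
    descent points at a common step. *)
Lemma closed_convex_cone_descent n (f : 'cV[R]_n -> \bar R) x :
  (forall x, f x != -oo%E) -> convex_efun f ->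
  closed_convex_cone (closed_descent_cone f x).
Proof.
move=> fNy cf; apply: closed_convex_cone_closure.
- by exists 1 => //=; rewrite scaler0 addr0.
- move=> y z [s /= s0 ys] [t /= t0 zt].
  pose r := Num.min s t; have r0 : 0 < r by rewrite lt_min s0.
  have yr : (f (x + r *: y)%R <= f x)%E.
    by apply: convex_efun_segment ys => //; rewrite ltW//= ge_min lexx.
  have zr : (f (x + r *: z)%R <= f x)%E.
    by apply: convex_efun_segment zt => //; rewrite ltW//= ge_min lexx orbT.
  exists (r / 2) => /=; first by rewrite divr_gt0.
  have h01 : 0 <= (2^-1 : R) <= 1.
    by rewrite invr_ge0 ler0n invf_le1 ?ltr0n// ler1n.
  have := cf 2^-1 (x + r *: y) (x + r *: z) h01.
  have h2 : 1 - 2^-1 = 2^-1 :> R by field.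
  have -> : 2^-1 *: (x + r *: y) + (1 - 2^-1) *: (x + r *: z)
      = x + (r / 2) *: (y + z).
    rewrite h2 !scalerDr addrACA -scalerDl !scalerA (mulrC _ r).
    by rewrite (_ : 2^-1 + 2^-1 = 1) ?scale1r//; field.
  rewrite h2 => /le_trans; apply.
  case fxE : (f x) yr zr => [c||] yr zr; last by move: (fNy x); rewrite fxE.
    apply: (@le_trans _ _ (2^-1%:E * c%:E + 2^-1%:E * c%:E)%E).
      by apply: leeD; apply: lee_wpmul2l => //; rewrite lee_fin; lra.
    by rewrite -!EFinM -EFinD lee_fin -mulrDl (_ : _ + _ = 1) ?mul1r//; field.
  exact: leey.
- move=> a y a0 [s /= s0 ys]; exists (s / a) => /=; first by rewrite divr_gt0.
  by rewrite scalerA divfK// gt_eqF.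
Qed.

Lemma closed_descent_cone_comp n (g : 'cV[R]_n -> \bar R) (D : 'M[R]_n) x y :
  D \in unitmx ->
  closed_descent_cone (fun x => g (D *m x)) x y <->
  closed_descent_cone g (D *m x) (D *m y).
Proof.
move=> uD.
have descE z : descent_cone (fun x => g (D *m x)) x z <->
    descent_cone g (D *m x) (D *m z).
  by split=> -[t t0 /= tz]; exists t => //=; move: tz; rewrite mulmxDr -scalemxAr.
split=> [Ky|Cy] B nB.
  by have [z [/descE Cz Bz]] := Ky _ (mulmx_continuous nB); exists (D *m z).
have {}nB : nbhs (invmx D *m (D *m y)) B by rewrite mulmxA mulVmx// mul1mx.
have [z [Cz Bz]] := Cy _ (mulmx_continuous nB); exists (invmx D *m z).
by split => //; apply/descE; rewrite mulmxA mulmxV// mul1mx.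
Qed.

End cone_maps.

(** * Condition numbers *)

Section condition_numbers.
Context {R : realType}.

Lemma enorm_le_opnorm p n (A : 'M[R]_(p, n)) x :
  enorm (A *m x) <= opnorm A * enorm x.
Proof.
have [M M0 AM] := mulmx_bounded A.
have [->|x0] := eqVneq x 0; first by rewrite mulmx0 !enorm0 mulr0.
have nx : 0 < enorm x by rewrite lt_def enorm_eq0 x0 enorm_ge0.
have : enorm (A *m ((enorm x)^-1 *: x)) <= opnorm A.
  apply: ub_le_sup.
    by exists M => _ /= [z z1 <-]; rewrite (le_trans (AM z))// ler_piMr// ltW.
  exists ((enorm x)^-1 *: x) => //=.
  by rewrite enormZ ger0_norm ?invr_ge0 ?enorm_ge0// mulVf ?gt_eqF.
rewrite -scalemxAr enormZ ger0_norm ?invr_ge0 ?enorm_ge0// mulrC.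
by rewrite ler_pdivrMr.
Qed.

Lemma exists_unit_vector n : (0 < n)%N -> exists x : 'cV[R]_n, enorm x = 1.
Proof.
case: n => // n _; exists (vcons 1 0); apply/eqP.
rewrite -(@eqrXn2 _ 2) ?enorm_ge0// enorm_sqr dot_vcons.
by rewrite dot0l mulr1 addr0 expr1n.
Qed.

Lemma opnorm_unitmx_gt0 n (A : 'M[R]_n) : (0 < n)%N -> A \in unitmx ->
  0 < opnorm A.
Proof.
move=> n0 uA; have [x x1] := exists_unit_vector n0.
have [M M0 AM] := mulmx_bounded (invmx A).
rewrite ltNge; apply/negP => A0.
have := AM (A *m x); rewrite mulmxA mulVmx// mul1mx x1 => h.
have := enorm_le_opnorm A x; rewrite x1 mulr1 => h'.
have := ler_wpM2l (ltW M0) (le_trans h' A0); lra.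
Qed.

(** The singular values of the condition numbers are infima of this shape; the
    lemma replaces them by real numbers with the two properties of an infimum. *)
Lemma ereal_inf_EFin (T : Type) (A : set T) (f : T -> R) :
  A !=set0 -> (forall x, 0 <= f x) ->
  exists s, [/\ ereal_inf [set (f x)%:E | x in A] = s%:E, 0 <= s,
    forall x, A x -> s <= f x & forall b, (forall x, A x -> b <= f x) -> b <= s].
Proof.
move=> [a Aa] f0; set S := [set _ | _ in _].
have lb b : (forall x, A x -> b <= f x) -> (b%:E <= ereal_inf S)%E.
  by move=> Ab; apply/ereal_infP => _ [x Ax <-]; rewrite lee_fin Ab.
have ub x : A x -> (ereal_inf S <= (f x)%:E)%E.
  by move=> Ax; apply: ereal_inf_lbound; exists x.
have Sfin : ereal_inf S \is a fin_num.
  have := lb 0 (fun x _ => f0 x); have := ub a Aa.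
  by case: (ereal_inf S).
exists (fine (ereal_inf S)); split; first by rewrite fineK.
- by rewrite -lee_fin fineK//; exact: lb (fun x _ => f0 x).
- by move=> x Ax; rewrite -lee_fin fineK//; exact: ub.
- by move=> b Ab; rewrite -lee_fin fineK//; exact: lb.
Qed.

(** Homogeneity extends a bound from the unit vectors of P to all of P. *)
Lemma sphere_lower_bound n (P : set 'cV[R]_n) (h : 'cV[R]_n -> R) s :
  (forall a x, 0 <= a -> P x -> P (a *: x)) -> (forall x, 0 <= h x) ->
  (forall a x, 0 <= a -> h (a *: x) <= a * h x) ->
  (forall x, P x -> enorm x = 1 -> s <= h x) ->
  forall x, P x -> s * enorm x <= h x.
Proof.
move=> PZ h0 hZ hs x Px; have [->|x0] := eqVneq x 0.
  by rewrite enorm0 mulr0.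
have nx : 0 < enorm x by rewrite lt_def enorm_eq0 x0 enorm_ge0.
have nxV : 0 <= (enorm x)^-1 by rewrite invr_ge0 ltW.
have := hs _ (PZ _ _ nxV Px); rewrite enormZ ger0_norm// mulVf ?gt_eqF//.
by move=> /(_ erefl) /le_trans/(_ (hZ _ _ nxV)); rewrite mulrC ler_pdivlMr.
Qed.

Lemma enorm_mulmxZ p n (A : 'M[R]_(p, n)) a x : 0 <= a ->
  enorm (A *m (a *: x)) <= a * enorm (A *m x).
Proof. by move=> a0; rewrite -scalemxAr enormZ ger0_norm. Qed.

Lemma sigma_min_unitmx n (A : 'M[R]_n) : (0 < n)%N -> A \in unitmx ->
  exists s, [/\ sigma_min A = s%:E, 0 < s &
    forall x, s * enorm x <= enorm (A *m x)].
Proof.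
move=> n0 uA; have [M M0 AM] := mulmx_bounded (invmx A).
have [x x1] := exists_unit_vector n0.
have [|s [sE s0 sl sb]] := @ereal_inf_EFin _ (@esphere R n)
    (fun x => enorm (A *m x)) _ (fun x => enorm_ge0 _); first by exists x.
exists s; split=> //.
  apply: (@lt_le_trans _ _ M^-1); first by rewrite invr_gt0.
  apply: sb => z z1; rewrite -[leLHS]mul1r ler_pdivrMr// mulrC -z1.
  by have := AM (A *m z); rewrite mulmxA mulVmx// mul1mx.
move=> z.
apply: (@sphere_lower_bound _ setT (fun x => enorm (A *m x))) => // [y|a y a0|y _].
- exact: enorm_ge0.
- exact: enorm_mulmxZ.
- exact: sl.
Qed.

Lemma equot_EFin (a s : R) : 0 < s -> equot a%:E s%:E = (a / s)%:E.
Proof. by move=> s0; rewrite /equot eqe gt_eqF// inver gt_eqF. Qed.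

(** Both 1 / sigma(D) and 1 / sigma(D^T) bound the inverse of D, so that it does
    not matter which quotient realises the minimum. *)
Lemma kappa_unitmxP n (D : 'M[R]_n) : (0 < n)%N -> D \in unitmx ->
  exists b, [/\ 0 < b, kappa D = (opnorm D * b)%:E &
    forall x, enorm (invmx D *m x) <= b * enorm x].
Proof.
move=> n0 uD; have [s [sE s0 sl]] := sigma_min_unitmx n0 uD.
have [t [tE t0 tl]] : exists t, [/\ sigma_min D^T = t%:E, 0 < t &
    forall x, t * enorm x <= enorm (D^T *m x)].
  by apply: (sigma_min_unitmx n0); rewrite unitmx_tr.
have bs x : enorm (invmx D *m x) <= s^-1 * enorm x.
  rewrite mulrC ler_pdivlMr// mulrC.
  by have := sl (invmx D *m x); rewrite mulmxA mulmxV// mul1mx.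
have bt x : enorm (invmx D *m x) <= t^-1 * enorm x.
  rewrite -[invmx D]trmxK; apply: trmx_contraction; first by rewrite invr_ge0 ltW.
  move=> y; rewrite mulrC ler_pdivlMr// mulrC trmx_inv.
  by have := tl (invmx D^T *m y); rewrite mulmxA mulmxV ?unitmx_tr// mul1mx.
rewrite /kappa sE tE !equot_EFin//.
rewrite /Order.min; case: ifP => _; [exists s^-1|exists t^-1];
  by split => //; rewrite invr_gt0.
Qed.

Section linear_preimage.
Variables (n : nat) (D : 'M[R]_n) (K C : set 'cV[R]_n).
Hypotheses (n0 : (0 < n)%N) (uD : D \in unitmx).
Hypotheses (Kc : closed_convex_cone K) (Cc : closed_convex_cone C).
Hypothesis KC : forall x, K x <-> C (D *m x).

Lemma preimage_invmx x : C x -> K (invmx D *m x).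
Proof. by move=> Cx; apply/KC; rewrite mulmxA mulmxV// mul1mx. Qed.

(** If C = {0} then K = {0} and its statistical dimension is 0. Otherwise the
    restricted singular value of the inverse of D is positive, as the inverse of D
    expands by at least 1 / |D|. *)
Lemma statdim_le_sigma_cone : statdim K = 0%E \/
  exists s, [/\ sigma_cone C (invmx D) = s%:E, 0 < s &
    (statdim K <= ((opnorm (invmx D) / s) ^+ 2)%:E * statdim C)%E].
Proof.
have uT : invmx D \in unitmx by rewrite unitmx_inv.
have [T0|/existsNP[c /not_implyP[Cc1 c0]]] :=
    pselect (forall x, C x -> x = 0).
  left; apply: statdim_eq0_of_trivial => // x /KC/T0 Dx0.
  by rewrite -[x]mul1mx -(mulVmx uD) -mulmxA Dx0 mulmx0.
right; have [C0 CD CZ Ccl] := Cc.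
have nc : 0 < enorm c by rewrite lt_def enorm_eq0 enorm_ge0 andbT; apply/eqP.
have [|s [sE s0 sl sb]] := @ereal_inf_EFin _ (C `&` @esphere R n)
    (fun x => enorm (invmx D *m x)) _ (fun x => enorm_ge0 _).
  exists ((enorm c)^-1 *: c); split.
    by apply: CZ => //; rewrite invr_ge0 ltW.
  by rewrite /esphere /= enormZ gtr0_norm ?invr_gt0// mulVf ?gt_eqF.
have [M M0 DM] := mulmx_bounded D.
have sp : 0 < s.
  apply: (@lt_le_trans _ _ M^-1); first by rewrite invr_gt0.
  apply: sb => z [_ z1]; rewrite -[leLHS]mul1r ler_pdivrMr// mulrC -z1.
  by have := DM (invmx D *m z); rewrite mulmxA mulmxV// mul1mx.
have sC x : C x -> s * enorm x <= enorm (invmx D *m x).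
  apply: (@sphere_lower_bound _ C (fun x => enorm (invmx D *m x)) _ CZ) => [y|a y a0|y Cy y1].
  - exact: enorm_ge0.
  - exact: enorm_mulmxZ.
  - exact: sl.
exists s; split=> //; rewrite (mulrC _ s^-1).
apply: (@statdim_le_of_map _ _ _ _ D (invmx D)) => //.
- exact: mulVmx.
- by move=> z /KC.
- by rewrite invr_ge0 ltW.
- exact: opnorm_unitmx_gt0.
- move=> z /KC/sC; rewrite mulmxA mulVmx// mul1mx => h.
  by rewrite mulrC ler_pdivlMr// mulrC.
- exact: enorm_le_opnorm.
Qed.

(** h_K x <= |x| = |- x|, and s |y| <= h_C (- T^T y) at y = - x. *)
Lemma statdim_le_sigma_to_cone :
  exists s, [/\ sigma_to_cone C (- (invmx D)^T) = s%:E, 0 <= s &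
    0 < s ->
    (statdim K <= ((opnorm (invmx D) / s) ^+ 2)%:E * statdim C)%E].
Proof.
have uT : invmx D \in unitmx by rewrite unitmx_inv.
have [x x1] := exists_unit_vector n0.
have [|s [sE s0 sl _]] := @ereal_inf_EFin _ (@esphere R n)
    (fun y => pnorm C (- (invmx D)^T *m y)) _ (fun y => pnorm_ge0 _ _).
  by exists x.
exists s; split=> // sp; rewrite (mulrC _ s^-1).
apply: (@statdim_le _ _ _ _ (invmx D)^T) => //.
- by rewrite invr_ge0 ltW.
- exact: opnorm_unitmx_gt0.
- move=> z; apply: le_trans (pnorm_le_enorm Kc z) _.
  rewrite mulrC ler_pdivlMr// mulrC -enormN.
  have -> : (invmx D)^T *m z = - (invmx D)^T *m (- z) by rewrite mulNmx mulmxN opprK.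
  apply: (@sphere_lower_bound _ setT
    (fun y => pnorm C (- (invmx D)^T *m y))) => // [y|a y a0|y _ y1].
  + exact: pnorm_ge0.
  + by rewrite -scalemxAr; exact: pnormZ_le.
  + exact: sl.
- apply: trmx_contraction; first exact/ltW/opnorm_unitmx_gt0.
  exact: enorm_le_opnorm.
Qed.

(** The first quotient is always finite, so that the minimum is finite; when
    the second one has a zero denominator it is +oo and the first one is the minimum. *)
Lemma statdim_le_renegar :
  (statdim K <= renegar C (invmx D) ^+ 2 * statdim C)%E.
Proof.
have [K0|[s [sE s0 sle]]] := statdim_le_sigma_cone.
  by rewrite K0 mule_ge0 ?statdim_ge0 ?sqre_ge0.
have [t [tE t0 tle]] := statdim_le_sigma_to_cone.
rewrite /renegar sE tE equot_EFin//.
have [t00|tn0] := eqVneq t 0.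
  rewrite t00 /equot eqxx /Order.min ltry.
  by rewrite -EFin_expe.
have tp : 0 < t by rewrite lt_def tn0.
rewrite equot_EFin//.
rewrite /Order.min; case: ifP => _; rewrite -EFin_expe //.
exact: tle.
Qed.

Lemma statdim_kappa :
  (equot (statdim C) (kappa D ^+ 2) <= statdim K
    <= kappa D ^+ 2 * statdim C)%E.
Proof.
have [b [b0 -> Tb]] := kappa_unitmxP n0 uD.
have a0 := opnorm_unitmx_gt0 n0 uD.
have ab : 0 < (opnorm D * b) ^+ 2 by rewrite exprn_gt0// mulr_gt0.
rewrite -EFin_expe; apply/andP; split.
  rewrite /equot eqe gt_eqF// inver gt_eqF// lee_pdivrMr// muleC.
  rewrite (mulrC _ b); apply: (@statdim_le_of_map _ _ _ _ (invmx D) D) => //.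
  - exact: mulmxV.
  - exact: preimage_invmx.
  - exact: ltW.
  - exact: enorm_le_opnorm.
apply: (@statdim_le_of_map _ _ _ _ D (invmx D)) => //.
- exact: mulVmx.
- by move=> z /KC.
- exact: ltW.
- by move=> z _; exact: enorm_le_opnorm.
Qed.

End linear_preimage.
End condition_numbers.

Theorem corollaryI2 (R : realType) (n : nat) (hn : (0 < n)%N)
    (g : 'cV[R]_n -> \bar R) (hproper : proper_fun g) (hconvex : convex_efun g)
    (D : 'M[R]_n) (hD : D \in unitmx) (x0 : 'cV[R]_n) :
  let f := fun x : 'cV[R]_n => g (D *m x) in
  (statdim_at f x0 <=
     renegar (closed_descent_cone g (D *m x0)) (invmx D) ^+ 2
       * statdim_at g (D *m x0))%E
  /\ (equot (statdim_at g (D *m x0)) (kappa D ^+ 2) <= statdim_at f x0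
        <= kappa D ^+ 2 * statdim_at g (D *m x0))%E.
Proof.
move=> f; have [gNy _] := hproper.
have Cc := closed_convex_cone_descent (D *m x0) gNy hconvex.
have KC x := closed_descent_cone_comp g x0 x hD.
have Kc : closed_convex_cone (closed_descent_cone f x0).
  apply: closed_convex_cone_descent => [x|t x y t01]; first exact: gNy.
  by rewrite /f mulmxDr -!scalemxAr; exact: hconvex.
by split; [exact: statdim_le_renegar|exact: statdim_kappa].
Qed.
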